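(* For all $z\in\mathbb{C}$ with $|z|<1$ we have $$\sum_{n\ge0}\frac{(2z)_n^2\,z^3}{n!^2\,(z+n)^3}\;=\;\frac{\Gamma(1+z)^2\,\Gamma(1-2z)}{\Gamma(1-z)^2\,\Gamma(1+2z)}\Bigl(1+z^2\psi^{(1)}(1+z)-z^2\psi^{(1)}(1-z)\Bigr),$$ where at $z=0$ (left side, term $n=0$) and at $z=\pm\frac12$ (right side) the expressions are understood by continuous extension across removable singularities.
   Context: $(x)_n=x(x+1)\cdots(x+n-1)$ (with $(x)_0=1$) is the rising Pochhammer symbol, and $\psi^{(k)}(z)=\frac{d^{k+1}}{dz^{k+1}}\log\Gamma(z)$ is the $k$-th polygamma function. *)

(* Defs.v *)
From Stdlib Require Import Reals Factorial.
From Coquelicot Require Import Coquelicot.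
Open Scope C_scope.

Definition Cexp (z : C) : C :=
  (exp (Re z) * cos (Im z), exp (Re z) * sin (Im z))%R.

Fixpoint pochhammer (x : C) (n : nat) : C :=
  match n with
  | O => 1
  | S k => pochhammer x k * (x + INR k)
  end.

(* [n! n^z / (z (z+1) ... (z+n))], whose limit is Gamma(z) (Euler-Gauss).  The
   power [n^z] is [exp (z ln n)]. *)
Definition Gamma_seq (z : C) (n : nat) : C :=
  INR (fact n) * Cexp (z * ln (INR n)) / pochhammer z (S n).

(* The limit exists for every [z] outside {0, -1, -2, ...}, so this is the
   meromorphic Gamma function; at its poles the value is meaningless. *)
Definition Gamma (z : C) : C :=
  (real (Lim_seq (fun n => Re (Gamma_seq z n))),
   real (Lim_seq (fun n => Im (Gamma_seq z n)))).

(* All local branches of [log Gamma] have the derivative [Gamma' / Gamma], so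
   [d^{k+1} log Gamma] is the [k]-th derivative of that quotient.  [C_derive]
   is the complex derivative wherever it exists ([C_derive_correct]). *)
Definition polygamma (k : nat) (z : C) : C :=
  Nat.iter k C_derive (fun w => C_derive Gamma w / Gamma w) z.

(* [l] is the value at [z] of the function given by the formula [f], extended
   by continuity at the points of [S].  Away from [S] it is [f z]; at a point
   of [S] it is the limit of [f] over a punctured neighbourhood, which is
   required to exist ([f z] itself is then a meaningless division by 0). *)
Definition extended_value (f : C -> C) (S : C -> Prop) (z l : C) : Prop :=
  (~ S z -> f z = l) /\ (S z -> filterlim f (locally' z) (locally l)).

Definition lhs_term (n : nat) (z : C) : C :=
  (pochhammer (2 * z) n ^ 2 * z ^ 3) / (INR (fact n) ^ 2 * (z + INR n) ^ 3).

Definition rhs (z : C) : C :=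
  (Gamma (1 + z) ^ 2 * Gamma (1 - 2 * z))
  / (Gamma (1 - z) ^ 2 * Gamma (1 + 2 * z))
  * (1 + z ^ 2 * polygamma 1 (1 + z) - z ^ 2 * polygamma 1 (1 - z)).

(* Main.v *)
(* Partial fractions in [y] of
     prod_{k=1}^{N+2} ((k-z)^2 - y) / prod_{n=0}^{N} ((z+n)^2 - y)
   have residues that split into (2z)_n^2 / n!^2 (z+n), a factor depending on N
   only, and a ratio tending to 1.  Taking the derivative at y = 0 turns the
   expansion into a finite form of the series; its other side is a quotient of
   Gamma products times
     sum_{n<=N} 1/(z+n)^2 - sum_{1<=k<=N+2} 1/(k-z)^2,
   and dominated convergence gives the theorem for z <> 0, 1/2, -1/2.  At
   z = 1/2 and z = -1/2 the Weierstrass M-test gives continuity of the series.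

   The choice of N+2 zeros against N+1 nodes matters: it keeps the ratios bounded
   uniformly in n <= N for all |z| < 1, and the polynomial part it creates is
   linear in y and negligible in the limit.  The expansion at y = 0 itself, a
   special case of Dougall's sum, converges only for Re z < 1/2. *)

Require Import Defs.
From Stdlib Require Import Reals Lra Lia Factorial.
From Coquelicot Require Import Coquelicot.
Open Scope R_scope.

(** [Gamma] is given only as a limit of Euler-Gauss products, so its convergence, its nonvanishing
    and the derivatives behind [polygamma 1] must come first. No theory of holomorphic functions
    enters: the product for z+h divided by the one for z is expanded to first order in h, with
    remainder at most a constant times |h|^2, the constant being independent of the truncation. Such
    a bound survives the limit of the truncations and then gives the derivative directly.

    The cube in the summand appears because the residue at the node (z+n)^2 carries a factor z+n,
    while the derivative at y = 0 divides it by (z+n)^4.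

    The three exceptional points are degeneracies of the expansion. At z = 0 the first node is y = 0
    itself; at z = -1/2 the nodes for n = 0 and n = 1 coincide; at z = 1/2 every node is cancelled
    by a zero of the numerator, so all residues vanish. *)

Lemma exp_le_compat x y : x <= y -> exp x <= exp y.
Proof. intros [H | ->]; [left; apply exp_increasing, H | right; reflexivity]. Qed.

(** * Limits of complex-valued functions along an arbitrary filter *)

Lemma Cmod_triangle_minus (a b : C) : Cmod a <= Cmod b + Cmod (b - a)%C.
Proof.
  pose proof (Cmod_triangle b (- (b - a))%C) as H. rewrite Cmod_opp in H.
  replace (b + - (b - a))%C with a in H by ring. exact H.
Qed.

(** The balls defining [locally] on [C] are squares; they agree with discs of the modulus up to the
    factor sqrt 2. All later limits are handled through the modulus. *)
Lemma filterlim_Cmod {T : Type} (F : (T -> Prop) -> Prop) {FF : Filter F}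
    (f : T -> C) (l : C) :
  filterlim f F (locally l) <->
  (forall eps, 0 < eps -> F (fun x => Cmod (f x - l)%C < eps)).
Proof.
  split; intros H.
  - intros eps He.
    assert (Hs : 0 < sqrt 2) by (apply sqrt_lt_R0; lra).
    assert (He' : 0 < eps / sqrt 2) by (apply Rdiv_lt_0_compat; lra).
    pose proof (proj1 (filterlim_locally f l) H (mkposreal _ He')) as H'.
    revert H'; apply filter_imp; intros x Hx.
    pose proof (C_NormedModule_mixin_compat2 l (f x) (mkposreal _ He') Hx) as Hy.
    simpl in Hy. replace (sqrt 2 * (eps / sqrt 2)) with eps in Hy by (field; lra).
    exact Hy.
  - apply filterlim_locally; intros eps.
    generalize (H eps (cond_pos eps)); apply filter_imp; intros x Hx.
    apply C_NormedModule_mixin_compat1; exact Hx.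
Qed.

Lemma Clim_plus {T : Type} (F : (T -> Prop) -> Prop) {FF : Filter F}
    (f g : T -> C) (a b : C) :
  filterlim f F (locally a) -> filterlim g F (locally b) ->
  filterlim (fun x => f x + g x)%C F (locally (a + b)%C).
Proof.
  intros Hf Hg. eapply filterlim_comp_2; [exact Hf | exact Hg |].
  exact (@filterlim_plus C_AbsRing C_NormedModule a b).
Qed.

Lemma Clim_mult {T : Type} (F : (T -> Prop) -> Prop) {FF : Filter F}
    (f g : T -> C) (a b : C) :
  filterlim f F (locally a) -> filterlim g F (locally b) ->
  filterlim (fun x => f x * g x)%C F (locally (a * b)%C).
Proof.
  rewrite 3!filterlim_Cmod by typeclasses eauto; intros Hf Hg eps He.
  set (A := Cmod a + 1); set (B := Cmod b).
  pose proof (Cmod_ge_0 a); pose proof (Cmod_ge_0 b).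
  assert (HA : 0 < eps / (2 * (A + 1))) by (apply Rdiv_lt_0_compat; unfold A; lra).
  assert (HB : 0 < eps / (2 * (B + 1))) by (apply Rdiv_lt_0_compat; unfold B; lra).
  generalize (filter_and _ _ (Hf 1 Rlt_0_1) (filter_and _ _ (Hf _ HB) (Hg _ HA))).
  apply filter_imp; intros x (H1 & H2 & H3).
  replace (f x * g x - a * b)%C with (f x * (g x - b) + (f x - a) * b)%C by ring.
  eapply Rle_lt_trans; [apply Cmod_triangle|]. rewrite 2!Cmod_mult.
  assert (Cmod (f x) <= A).
  { replace (f x) with (a + (f x - a))%C by ring.
    eapply Rle_trans; [apply Cmod_triangle|]. unfold A; lra. }
  assert (Cmod (f x) * Cmod (g x - b)%C <= A * (eps / (2 * (A + 1)))).
  { apply Rmult_le_compat; try apply Cmod_ge_0; lra. }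
  assert (Cmod (f x - a)%C * Cmod b <= eps / (2 * (B + 1)) * B).
  { apply Rmult_le_compat; try apply Cmod_ge_0; [lra | right; reflexivity]. }
  assert (eps / 2 = A * (eps / (2 * (A + 1))) + eps / (2 * (A + 1))) by (field; unfold A; lra).
  assert (eps / 2 = eps / (2 * (B + 1)) * B + eps / (2 * (B + 1))) by (field; unfold B; lra).
  lra.
Qed.

Lemma Clim_inv {T : Type} (F : (T -> Prop) -> Prop) {FF : Filter F}
    (f : T -> C) (a : C) :
  a <> 0%C -> filterlim f F (locally a) ->
  filterlim (fun x => / f x)%C F (locally (/ a)%C).
Proof.
  intros Ha. rewrite 2!filterlim_Cmod by typeclasses eauto; intros Hf eps He.
  apply Cmod_gt_0 in Ha as HA. set (A := Cmod a) in *.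
  assert (H1 : 0 < A / 2) by lra.
  assert (H2 : 0 < eps * (A * A / 2)) by (apply Rmult_lt_0_compat; nra).
  generalize (filter_and _ _ (Hf _ H1) (Hf _ H2)).
  apply filter_imp; intros x (H3 & H4).
  assert (H5 : A / 2 <= Cmod (f x)).
  { pose proof (Cmod_triangle_minus a (f x)) as H6. fold A in H6. lra. }
  assert (Hx : f x <> 0%C) by (apply Cmod_gt_0; lra).
  replace (/ f x - / a)%C with (- ((f x - a) / (f x * a)))%C by (field; auto).
  rewrite Cmod_opp, Cmod_div by (apply Cmult_neq_0; auto). rewrite Cmod_mult. fold A.
  apply Rmult_lt_reg_r with (Cmod (f x) * A); [nra|].
  replace (Cmod (f x - a)%C / (Cmod (f x) * A) * (Cmod (f x) * A))
    with (Cmod (f x - a)%C) by (field; split; lra).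
  eapply Rlt_le_trans; [exact H4|]. nra.
Qed.

Lemma Clim_opp {T : Type} (F : (T -> Prop) -> Prop) {FF : Filter F}
    (f : T -> C) (a : C) :
  filterlim f F (locally a) -> filterlim (fun x => - f x)%C F (locally (- a)%C).
Proof.
  intros Hf. eapply filterlim_comp; [exact Hf|].
  exact (@filterlim_opp C_AbsRing C_NormedModule a).
Qed.

Lemma Clim_minus {T : Type} (F : (T -> Prop) -> Prop) {FF : Filter F}
    (f g : T -> C) (a b : C) :
  filterlim f F (locally a) -> filterlim g F (locally b) ->
  filterlim (fun x => f x - g x)%C F (locally (a - b)%C).
Proof. intros Hf Hg. apply Clim_plus; [exact FF | exact Hf | exact (Clim_opp F g b Hg)]. Qed.

Lemma Clim_div {T : Type} (F : (T -> Prop) -> Prop) {FF : Filter F}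
    (f g : T -> C) (a b : C) :
  b <> 0%C -> filterlim f F (locally a) -> filterlim g F (locally b) ->
  filterlim (fun x => f x / g x)%C F (locally (a / b)%C).
Proof. intros Hb Hf Hg. apply Clim_mult; [exact FF | exact Hf | apply Clim_inv; auto]. Qed.

Lemma Clim_pow {T : Type} (F : (T -> Prop) -> Prop) {FF : Filter F}
    (f : T -> C) (a : C) (n : nat) :
  filterlim f F (locally a) -> filterlim (fun x => f x ^ n)%C F (locally (a ^ n)%C).
Proof.
  intros Hf. induction n; simpl; [apply filterlim_const | apply Clim_mult; auto].
Qed.

Lemma Clim_unique {T : Type} (F : (T -> Prop) -> Prop) {FF : ProperFilter' F}
    (f : T -> C) (a b : C) :
  filterlim f F (locally a) -> filterlim f F (locally b) -> a = b.
Proof. exact (@filterlim_locally_unique _ C_AbsRing C_NormedModule F _ f a b). Qed.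

Lemma Clim_le {T : Type} (F : (T -> Prop) -> Prop) {FF : ProperFilter F}
    (f : T -> C) (a : C) (B : R) :
  F (fun x => Cmod (f x) <= B) -> filterlim f F (locally a) -> Cmod a <= B.
Proof.
  rewrite filterlim_Cmod by typeclasses eauto. intros HB Hf. apply le_epsilon; intros eps He.
  destruct (filter_ex _ (filter_and _ _ HB (Hf eps He))) as [x [H1 H2]].
  pose proof (Cmod_triangle_minus a (f x)). lra.
Qed.

(** * Finite sums and products of the first [n] terms *)

Fixpoint Rsum (f : nat -> R) (n : nat) : R :=
  match n with O => 0 | S k => Rsum f k + f k end.

Fixpoint Csum (f : nat -> C) (n : nat) : C :=
  match n with O => 0%C | S k => (Csum f k + f k)%C end.

Fixpoint Cprod (f : nat -> C) (n : nat) : C :=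
  match n with O => 1%C | S k => (Cprod f k * f k)%C end.

Lemma sum_n_Csum (f : nat -> C) n : sum_n f n = Csum f (S n).
Proof.
  induction n.
  - rewrite sum_O. simpl. ring.
  - rewrite sum_Sn, IHn. reflexivity.
Qed.

Lemma sum_n_Rsum (f : nat -> R) n : sum_n f n = Rsum f (S n).
Proof.
  induction n.
  - rewrite sum_O. simpl. ring.
  - rewrite sum_Sn, IHn. reflexivity.
Qed.

Lemma Csum_ext f g n : (forall k, (k < n)%nat -> f k = g k) -> Csum f n = Csum g n.
Proof. induction n; simpl; intros H; [auto|rewrite IHn, H; auto]. Qed.

Lemma Cprod_ext f g n : (forall k, (k < n)%nat -> f k = g k) -> Cprod f n = Cprod g n.
Proof. induction n; simpl; intros H; [auto|rewrite IHn, H; auto]. Qed.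

Lemma Csum_plus f g n : Csum (fun k => f k + g k)%C n = (Csum f n + Csum g n)%C.
Proof. induction n; simpl; [ring|rewrite IHn; ring]. Qed.

Lemma Csum_scal c f n : Csum (fun k => c * f k)%C n = (c * Csum f n)%C.
Proof. induction n; simpl; [ring|rewrite IHn; ring]. Qed.

Lemma Rsum_scal c f n : Rsum (fun k => c * f k) n = c * Rsum f n.
Proof. induction n; simpl; [ring|rewrite IHn; ring]. Qed.

Lemma Cprod_mult f g n : Cprod (fun k => f k * g k)%C n = (Cprod f n * Cprod g n)%C.
Proof. induction n; simpl; [ring|rewrite IHn; ring]. Qed.

Lemma Cprod_neq_0 (f : nat -> C) n : (forall k, (k < n)%nat -> f k <> 0%C) -> Cprod f n <> 0%C.
Proof.
  induction n; simpl; intros H; [apply C1_nz|].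
  apply Cmult_neq_0; [apply IHn; intros k Hk|]; apply H; lia.
Qed.

Lemma Cprod_inv (f : nat -> C) n : (forall k, (k < n)%nat -> f k <> 0%C) ->
  Cprod (fun k => / f k)%C n = (/ Cprod f n)%C.
Proof.
  induction n; simpl; intros H; [field|].
  rewrite IHn by auto. field. split; [apply H; lia|].
  apply Cprod_neq_0. intros k Hk; apply H; lia.
Qed.

Lemma Rsum_le f g n : (forall k, (k < n)%nat -> f k <= g k) -> Rsum f n <= Rsum g n.
Proof.
  induction n; simpl; intros H; [lra|].
  specialize (IHn ltac:(auto)). specialize (H n ltac:(lia)). lra.
Qed.

Lemma Rsum_ge_0 f n : (forall k, 0 <= f k) -> 0 <= Rsum f n.
Proof. induction n; simpl; intros H; [lra|]. specialize (IHn H). specialize (H n). lra. Qed.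

Lemma Cmod_Csum f n : Cmod (Csum f n) <= Rsum (fun k => Cmod (f k)) n.
Proof.
  induction n; simpl; [rewrite Cmod_0; lra|].
  eapply Rle_trans; [apply Cmod_triangle|]. lra.
Qed.

Lemma Cmod_Csum_le f e B : (forall k, Cmod (f k) <= e k) -> (forall n, Rsum e n <= B) ->
  forall n, Cmod (Csum f n) <= B.
Proof.
  intros H HB n. eapply Rle_trans; [apply Cmod_Csum|].
  eapply Rle_trans; [apply Rsum_le; intros; apply H|]. apply HB.
Qed.

Lemma Rsum_bounded_ex_series e B :
  (forall k, 0 <= e k) -> (forall n, Rsum e n <= B) -> ex_series e.
Proof.
  intros H0 HB.
  destruct (ex_finite_lim_seq_incr (sum_n e) B) as [l Hl].
  - intros n. rewrite sum_Sn. specialize (H0 (S n)). unfold plus; simpl. lra.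
  - intros n. rewrite sum_n_Rsum. apply HB.
  - exists l. exact Hl.
Qed.

(** [sum_n] includes the index n and [Csum] stops before it, so the two sequences of partial sums
    differ by a shift of one. *)
Lemma is_series_Csum (f : nat -> C) (l : C) :
  is_series f l <-> filterlim (Csum f) eventually (locally l).
Proof.
  unfold is_series. split; intros H.
  - apply filterlim_Cmod; [typeclasses eauto|]. intros eps He.
    apply (proj1 (filterlim_Cmod eventually (sum_n f) l)) with (eps := eps) in H; auto.
    destruct H as [N HN]. exists (S N). intros n Hn. destruct n; [lia|].
    rewrite <- sum_n_Csum. apply HN. lia.
  - apply (filterlim_ext (fun n => Csum f (S n))).
    { intros n. symmetry. apply sum_n_Csum. }
    eapply filterlim_comp; [|exact H].
    intros P [N HN]. exists N. intros n Hn. apply HN. lia.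
Qed.

Lemma Csum_abs_cv f e B :
  (forall k, Cmod (f k) <= e k) -> (forall n, Rsum e n <= B) ->
  exists l : C, filterlim (Csum f) eventually (locally l).
Proof.
  intros H HB.
  assert (He : ex_series e).
  { apply Rsum_bounded_ex_series with B; auto. intros k.
    eapply Rle_trans; [apply Cmod_ge_0|apply H]. }
  destruct (@ex_series_le C_AbsRing C_CompleteNormedModule f e) as [l Hl]; auto.
  exists l. apply is_series_Csum. exact Hl.
Qed.

Lemma Rsum_tail e B : (forall k, 0 <= e k) -> (forall n, Rsum e n <= B) ->
  forall eps, 0 < eps -> exists N, forall n, Rsum e n - Rsum e N < eps.
Proof.
  intros H0 HB eps He.
  assert (Hmono : forall m n, (m <= n)%nat -> Rsum e m <= Rsum e n).
  { intros m n Hmn. induction Hmn; [lra|]. simpl. specialize (H0 m0). lra. }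
  destruct (completeness (fun x => exists n, x = Rsum e n)) as [l [Hl1 Hl2]].
  - exists B. intros x [n ->]. apply HB.
  - exists (Rsum e 0). now exists 0%nat.
  (* N is taken with the N-th partial sum within eps of the supremum l; if there were none, l - eps
     would be a smaller upper bound. *)
  - destruct (Classical_Prop.classic (exists N, l - eps < Rsum e N)) as [[N HN]|Hn].
    + exists N. intros n. assert (Rsum e n <= l) by (apply Hl1; now exists n). lra.
    + assert (l <= l - eps); [|lra]. apply Hl2. intros x [n ->].
      apply Rnot_lt_le. intros Hlt. apply Hn. now exists n.
Qed.

Lemma Csum_tail_le f e N n : (N <= n)%nat -> (forall k, Cmod (f k) <= e k) ->
  Cmod (Csum f n - Csum f N)%C <= Rsum e n - Rsum e N.
Proof.
  intros Hn H. induction Hn.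
  - replace (Csum f N - Csum f N)%C with (RtoC 0) by ring. rewrite Cmod_0. lra.
  - simpl. replace (Csum f m + f m - Csum f N)%C with ((Csum f m - Csum f N) + f m)%C by ring.
    eapply Rle_trans; [apply Cmod_triangle|]. specialize (H m). lra.
Qed.

(** * Infinite products *)

Section Products.
Variables (a : nat -> C) (e : nat -> R).
Hypothesis (Hae : forall k, Cmod (a k) <= e k).

Let e_ge_0 k : 0 <= e k.
Proof. eapply Rle_trans; [apply Cmod_ge_0|apply Hae]. Qed.

Lemma Cmod_Cprod_le n : Cmod (Cprod (fun k => 1 + a k)%C n) <= exp (Rsum e n).
Proof.
  induction n; simpl; [rewrite Cmod_1, exp_0; lra|].
  rewrite Cmod_mult, exp_plus. apply Rmult_le_compat; auto using Cmod_ge_0.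
  eapply Rle_trans; [apply Cmod_triangle|]. rewrite Cmod_1.
  eapply Rle_trans; [|apply exp_ineq1_le]. specialize (Hae n). lra.
Qed.

(** With P the product so far, a new factor adds [a n * P], of modulus at most
    [e n * exp (Rsum e n)]; the form S exp S of the bound absorbs this increment. *)
Lemma Cprod_first_order n :
  Cmod (Cprod (fun k => 1 + a k)%C n - 1)%C <= Rsum e n * exp (Rsum e n).
Proof.
  induction n; simpl.
  { replace (1 - 1)%C with (RtoC 0) by ring. rewrite Cmod_0. lra. }
  set (P := Cprod _ n) in *. pose proof (Cmod_Cprod_le n) as HP. fold P in HP.
  replace (P * (1 + a n) - 1)%C with ((P - 1) + a n * P)%C by ring.
  eapply Rle_trans; [apply Cmod_triangle|]. rewrite Cmod_mult.
  pose proof (Rsum_ge_0 e n e_ge_0). pose proof (e_ge_0 n) as He0. pose proof (Hae n).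
  assert (exp (Rsum e n) <= exp (Rsum e n + e n)) by (apply exp_le_compat; lra).
  assert (Cmod (a n) * Cmod P <= e n * exp (Rsum e n)).
  { apply Rmult_le_compat; auto using Cmod_ge_0. }
  pose proof (exp_pos (Rsum e n)). nra.
Qed.

(** Subtracting the linear part as well changes the increment to [a n * (P - 1)], which the
    first-order bound makes quadratic in [e]. This is the source of the |h|^2 remainder for
    Gamma. *)
Lemma Cprod_second_order n :
  Cmod (Cprod (fun k => 1 + a k)%C n - 1 - Csum a n)%C <= (Rsum e n) ^ 2 * exp (Rsum e n).
Proof.
  induction n; simpl Cprod; simpl Csum; simpl Rsum.
  { replace (1 - 1 - 0)%C with (RtoC 0) by ring. rewrite Cmod_0. simpl. lra. }
  set (P := Cprod _ n) in *. pose proof (Cprod_first_order n) as HP. fold P in HP.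
  replace (P * (1 + a n) - 1 - (Csum a n + a n))%C
    with ((P - 1 - Csum a n) + a n * (P - 1))%C by ring.
  eapply Rle_trans; [apply Cmod_triangle|]. rewrite Cmod_mult.
  pose proof (Rsum_ge_0 e n e_ge_0). pose proof (e_ge_0 n) as He0. pose proof (Hae n).
  assert (exp (Rsum e n) <= exp (Rsum e n + e n)) by (apply exp_le_compat; lra).
  assert (Cmod (a n) * Cmod (P - 1)%C <= e n * (Rsum e n * exp (Rsum e n))).
  { apply Rmult_le_compat; auto using Cmod_ge_0. }
  pose proof (exp_pos (Rsum e n)).
  apply Rle_trans with ((Rsum e n + e n) ^ 2 * exp (Rsum e n)).
  - assert (0 <= Rsum e n * e n) by nra. nra.
  - apply Rmult_le_compat_l; auto. apply pow2_ge_0.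
Qed.

Lemma Cprod_cv B : (forall n, Rsum e n <= B) ->
  exists l : C, filterlim (Cprod (fun k => 1 + a k)%C) eventually (locally l).
Proof.
  intros HB. set (P := Cprod (fun k => 1 + a k)%C).
  (* Telescoping the increments turns the product into a series, absolutely convergent because every
     P k is bounded by exp B. *)
  assert (HP : forall n, P n = (1 + Csum (fun k => a k * P k) n)%C).
  { induction n; [unfold P; simpl; ring|].
    change (P n * (1 + a n) = 1 + (Csum (fun k => a k * P k) n + a n * P n))%C.
    rewrite Cplus_assoc, <- IHn. ring. }
  destruct (Csum_abs_cv (fun k => a k * P k)%C (fun k => exp B * e k) (exp B * B)) as [l Hl].
  - intros k. rewrite Cmod_mult, Rmult_comm. apply Rmult_le_compat; auto using Cmod_ge_0.
    eapply Rle_trans; [apply Cmod_Cprod_le|]. apply exp_le_compat; auto.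
  - intros n. rewrite Rsum_scal. apply Rmult_le_compat_l; auto. left; apply exp_pos.
  - exists (1 + l)%C. eapply filterlim_ext; [intros n; symmetry; apply HP|].
    apply Clim_plus; [typeclasses eauto|apply filterlim_const|exact Hl].
Qed.

End Products.

(** * The complex exponential *)

Lemma Cexp_plus u v : Cexp (u + v)%C = (Cexp u * Cexp v)%C.
Proof.
  destruct u as [a b], v as [c d]. unfold Cexp, Cmult; simpl.
  rewrite exp_plus, cos_plus, sin_plus. f_equal; ring.
Qed.

Lemma Cexp_0 : Cexp 0 = 1%C.
Proof. unfold Cexp; simpl. rewrite exp_0, cos_0, sin_0. unfold RtoC. f_equal; ring. Qed.

Lemma Cmod_Cexp u : Cmod (Cexp u) = exp (Re u).
Proof.
  unfold Cmod, Cexp; simpl fst; simpl snd.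
  replace ((exp (Re u) * cos (Im u)) ^ 2 + (exp (Re u) * sin (Im u)) ^ 2)
    with (exp (Re u) ^ 2).
  - apply sqrt_pow2. left; apply exp_pos.
  - pose proof (sin2_cos2 (Im u)) as H. unfold Rsqr in H.
    transitivity (exp (Re u) ^ 2 * (sin (Im u) * sin (Im u) + cos (Im u) * cos (Im u)));
      [rewrite H|]; ring.
Qed.

Lemma Cexp_neq_0 u : Cexp u <> 0%C.
Proof. apply Cmod_gt_0. rewrite Cmod_Cexp. apply exp_pos. Qed.

Lemma Cexp_opp u : Cexp (- u)%C = (/ Cexp u)%C.
Proof.
  pose proof (Cexp_plus u (- u)%C) as H. rewrite Cplus_opp_r, Cexp_0 in H.
  replace (Cexp (- u)%C) with (/ Cexp u * (Cexp u * Cexp (- u)))%C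
    by (field; apply Cexp_neq_0).
  rewrite <- H. ring.
Qed.

Lemma Rabs_exp_minus_1 x : Rabs (exp x - 1) <= Rabs x * exp (Rabs x).
Proof.
  pose proof (exp_ineq1_le x) as H1. pose proof (exp_ineq1_le (- x)) as H2.
  assert (H3 : exp x * exp (- x) = 1) by (rewrite <- exp_plus, Rplus_opp_r; apply exp_0).
  pose proof (exp_pos x). pose proof (exp_pos (- x)).
  destruct (Rle_dec 0 x).
  - rewrite (Rabs_right x) by lra. rewrite Rabs_right by lra. nra.
  - rewrite (Rabs_left x) by lra. rewrite Rabs_left1; nra.
Qed.

Lemma Rabs_exp_minus_1_minus x : Rabs (exp x - 1 - x) <= x ^ 2 * exp (Rabs x).
Proof.
  pose proof (exp_ineq1_le x) as H1. pose proof (exp_ineq1_le (- x)) as H2.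
  assert (H3 : exp x * exp (- x) = 1) by (rewrite <- exp_plus, Rplus_opp_r; apply exp_0).
  pose proof (exp_pos x). pose proof (exp_pos (- x)).
  rewrite Rabs_right by lra.
  assert (exp x - 1 - x <= x * (exp x - 1)) by nra.
  pose proof (Rle_abs (x * (exp x - 1))) as H6. rewrite Rabs_mult in H6.
  pose proof (Rabs_exp_minus_1 x). rewrite <- (pow2_abs x). pose proof (Rabs_pos x). nra.
Qed.

Lemma Rabs_sin_le x : Rabs (sin x) <= Rabs x.
Proof.
  assert (Hp : forall y, 0 <= y -> Rabs (sin y) <= y).
  { intros y Hy. destruct (Rle_dec y 1) as [Hy1|Hy1].
    - destruct Hy as [Hy| <-]; [|rewrite sin_0, Rabs_R0; lra].
      pose proof (sin_lt_x y Hy). pose proof PI2_1.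
      rewrite Rabs_right; [lra|]. apply Rle_ge, sin_ge_0; lra.
    - apply Rabs_le. pose proof (SIN_bound y). lra. }
  destruct (Rle_dec 0 x).
  - rewrite (Rabs_right x) by lra. apply Hp; auto.
  - rewrite (Rabs_left x) by lra. rewrite <- Rabs_Ropp, <- sin_neg. apply Hp; lra.
Qed.

Lemma one_minus_cos x : 1 - cos x = 2 * (sin (x / 2)) ^ 2.
Proof.
  replace x with (2 * (x / 2)) at 1 by field. rewrite cos_2a_sin. ring.
Qed.

(** The mean value theorem gives sin x - x = x (cos c - 1) with |c| <= |x|, and 1 - cos c = 2
    sin(c/2)^2 <= 2 |sin(c/2)| <= |c|. A quadratic bound, weaker than the true cubic one, suffices
    here. *)
Lemma Rabs_sin_minus x : Rabs (sin x - x) <= x ^ 2.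
Proof.
  destruct (MVT_gen sin 0 x cos) as [c [Hc Heq]].
  - intros y _. apply is_derive_Reals, derivable_pt_lim_sin.
  - intros y _. apply continuity_sin.
  - rewrite sin_0 in Heq. replace (sin x - x) with (x * - (1 - cos c)) by lra.
    rewrite Rabs_mult, Rabs_Ropp. rewrite <- pow2_abs. simpl. rewrite Rmult_1_r.
    apply Rmult_le_compat_l; [apply Rabs_pos|].
    assert (Hcx : Rabs c <= Rabs x).
    { revert Hc. unfold Rmin, Rmax, Rabs.
      destruct (Rle_dec 0 x), (Rcase_abs c), (Rcase_abs x); lra. }
    eapply Rle_trans; [|exact Hcx]. rewrite one_minus_cos.
    pose proof (Rabs_sin_le (c / 2)) as Hs.
    replace (Rabs c) with (2 * Rabs (c / 2)).
    2:{ unfold Rdiv. rewrite Rabs_mult, (Rabs_right (/ 2)) by lra. field. }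
    rewrite Rabs_right by (pose proof (pow2_ge_0 (sin (c / 2))); lra).
    assert (sin (c / 2) ^ 2 <= Rabs (sin (c / 2))).
    { rewrite <- pow2_abs. pose proof (Rabs_pos (sin (c / 2))).
      assert (Rabs (sin (c / 2)) <= 1) by (apply Rabs_le, SIN_bound). nra. }
    lra.
Qed.

Lemma Rabs_one_minus_cos x : Rabs (1 - cos x) <= x ^ 2.
Proof.
  rewrite one_minus_cos. pose proof (Rabs_sin_le (x / 2)) as Hs.
  rewrite Rabs_right by (pose proof (pow2_ge_0 (sin (x / 2))); lra).
  rewrite <- (pow2_abs (sin _)). rewrite <- (pow2_abs x).
  replace (Rabs (x / 2)) with (Rabs x / 2) in Hs.
  2:{ unfold Rdiv. rewrite Rabs_mult, (Rabs_right (/ 2)) by lra. field. }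
  pose proof (Rabs_pos (sin (x / 2))). nra.
Qed.

Lemma Cmod_le_Rabs (w : C) : Cmod w <= Rabs (Re w) + Rabs (Im w).
Proof.
  destruct w as [x y]. simpl.
  replace (x, y) with (RtoC x + Ci * RtoC y)%C.
  - eapply Rle_trans; [apply Cmod_triangle|]. rewrite Cmod_mult, !Cmod_R.
    replace (Cmod Ci) with 1; [lra|].
    unfold Cmod; simpl. replace (0 * (0 * 1) + 1 * (1 * 1)) with 1 by ring. now rewrite sqrt_1.
  - unfold Cplus, Cmult, Ci, RtoC; simpl. f_equal; ring.
Qed.

Lemma im_le_Cmod (w : C) : Rabs (Im w) <= Cmod w.
Proof.
  replace (Im w) with (Re (- Ci * w)%C).
  - eapply Rle_trans; [apply re_le_Cmod|]. rewrite Cmod_mult, Cmod_opp.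
    replace (Cmod Ci) with 1; [lra|].
    unfold Cmod; simpl. replace (0 * (0 * 1) + 1 * (1 * 1)) with 1 by ring. now rewrite sqrt_1.
  - destruct w; unfold Ci; simpl. ring.
Qed.

(** Real and imaginary parts split into four pieces, each at most exp M |w|^2, so the factor 5
    leaves some slack. *)
Lemma Cmod_Cexp_minus (w : C) (M : R) : Cmod w <= M ->
  Cmod (Cexp w - 1 - w)%C <= 5 * exp M * Cmod w ^ 2.
Proof.
  intros HM. pose proof (re_le_Cmod w) as Hx. pose proof (im_le_Cmod w) as Hy.
  set (x := Re w) in *. set (y := Im w) in *. set (m := Cmod w) in *.
  assert (He : exp x <= exp M) by (apply exp_le_compat; pose proof (Rle_abs x); lra).
  assert (He' : exp (Rabs x) <= exp M) by (apply exp_le_compat; lra).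
  eapply Rle_trans; [apply Cmod_le_Rabs|].
  replace (Re (Cexp w - 1 - w)%C) with ((exp x - 1 - x) + exp x * - (1 - cos y))
    by (unfold x, y; destruct w; simpl; ring).
  replace (Im (Cexp w - 1 - w)%C) with (exp x * (sin y - y) + (exp x - 1) * y)
    by (unfold x, y; destruct w; simpl; ring).
  pose proof (Rabs_triang (exp x - 1 - x) (exp x * - (1 - cos y))) as H1.
  pose proof (Rabs_triang (exp x * (sin y - y)) ((exp x - 1) * y)) as H2.
  rewrite Rabs_mult, Rabs_Ropp, (Rabs_right (exp x)) in H1 by (left; apply exp_pos).
  rewrite !Rabs_mult, (Rabs_right (exp x)) in H2 by (left; apply exp_pos).
  pose proof (Rabs_exp_minus_1_minus x) as K1. pose proof (Rabs_exp_minus_1 x) as K2.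
  pose proof (Rabs_one_minus_cos y) as K3. pose proof (Rabs_sin_minus y) as K4.
  rewrite <- (pow2_abs x) in K1. rewrite <- (pow2_abs y) in K3, K4.
  pose proof (exp_pos x). pose proof (exp_pos (Rabs x)).
  pose proof (Rabs_pos x). pose proof (Rabs_pos y).
  pose proof (Rabs_pos (1 - cos y)). pose proof (Rabs_pos (sin y - y)).
  pose proof (Rabs_pos (exp x - 1)).
  assert (L1 : Rabs x ^ 2 * exp (Rabs x) <= exp M * m ^ 2).
  { rewrite Rmult_comm. apply Rmult_le_compat; try lra; [nra|]. apply pow_incr; lra. }
  assert (L2 : exp x * Rabs (1 - cos y) <= exp M * m ^ 2).
  { apply Rmult_le_compat; try lra. eapply Rle_trans; [exact K3|]. apply pow_incr; lra. }
  assert (L3 : exp x * Rabs (sin y - y) <= exp M * m ^ 2).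
  { apply Rmult_le_compat; try lra. eapply Rle_trans; [exact K4|]. apply pow_incr; lra. }
  assert (L4 : Rabs (exp x - 1) * Rabs y <= exp M * m ^ 2).
  { apply Rle_trans with ((m * exp M) * m); [|simpl; lra].
    apply Rmult_le_compat; try lra. eapply Rle_trans; [exact K2|].
    apply Rmult_le_compat; lra. }
  assert (0 <= exp M * m ^ 2) by (pose proof (exp_pos M); nra). lra.
Qed.

(** * Convergence and derivative of the Gamma function *)

Lemma Rsum_inv_sq_le n : Rsum (fun k => / (INR k + 1) ^ 2) n <= 2.
Proof.
  (* The correction -1/(n+1) makes the induction close, since 1/(n+2)^2 <= 1/(n+1) - 1/(n+2). *)
  assert (H : Rsum (fun k => / (INR k + 1) ^ 2) (S n) <= 2 - / (INR n + 1)).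
  { induction n; [simpl; lra|].
    change (Rsum (fun k => / (INR k + 1) ^ 2) (S (S n)))
      with (Rsum (fun k => / (INR k + 1) ^ 2) (S n) + / (INR (S n) + 1) ^ 2).
    rewrite S_INR. pose proof (pos_INR n).
    assert (/ (INR n + 1) - / (INR n + 1 + 1) - / (INR n + 1 + 1) ^ 2
            = / ((INR n + 1) * (INR n + 1 + 1) ^ 2)) by (field; lra).
    assert (0 < / ((INR n + 1) * (INR n + 1 + 1) ^ 2)).
    { apply Rinv_0_lt_compat, Rmult_lt_0_compat; [lra|apply pow_lt; lra]. }
    lra. }
  simpl in H. pose proof (pos_INR n).
  assert (0 < / (INR n + 1)) by (apply Rinv_0_lt_compat; lra).
  assert (0 < / (INR n + 1) ^ 2) by (apply Rinv_0_lt_compat, pow_lt; lra). simpl in *. lra.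
Qed.

(** Increments of ln n, used to spread the power n^h of [Gamma_seq] over the factors of the product.
    With the convention ln 0 = 0 the steps at 0 and 1 both vanish, so the sum over k <= n is ln n
    even for n = 0. *)
Definition log_step (k : nat) : R := ln (INR k) - ln (INR (pred k)).

Lemma ln_0 : ln 0 = 0.
Proof. unfold ln. destruct (Rlt_dec 0 0); [exfalso; lra | reflexivity]. Qed.

Lemma Rsum_log_step n : Rsum log_step (S n) = ln (INR n).
Proof.
  induction n.
  - unfold log_step. simpl. rewrite ln_0. ring.
  - change (Rsum log_step (S (S n))) with (Rsum log_step (S n) + log_step (S n)).
    rewrite IHn. unfold log_step. simpl pred. ring.
Qed.

Lemma ln_le_minus_1 x : 0 < x -> ln x <= x - 1.
Proof. intros Hx. pose proof (exp_ineq1_le (ln x)). rewrite exp_ln in H; lra. Qed.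

(** Both sides are ln x <= x - 1, applied to the ratio of consecutive integers and to its
    inverse. *)
Lemma log_step_bounds k : / (INR k + 2) <= log_step (S (S k)) <= / (INR k + 1).
Proof.
  unfold log_step. simpl pred. rewrite !S_INR. set (x := INR k).
  assert (Hx : 0 <= x) by apply pos_INR.
  replace (ln (x + 1 + 1) - ln (x + 1)) with (ln ((x + 2) / (x + 1))).
  2:{ rewrite ln_div by lra. do 2 f_equal. ring. }
  split.
  - pose proof (ln_le_minus_1 ((x + 1) / (x + 2)) ltac:(apply Rdiv_lt_0_compat; lra)) as H.
    rewrite ln_div in H by lra. rewrite ln_div by lra.
    replace ((x + 1) / (x + 2) - 1) with (- / (x + 2)) in H by (field; lra). lra.
  - pose proof (ln_le_minus_1 ((x + 2) / (x + 1)) ltac:(apply Rdiv_lt_0_compat; lra)) as H.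
    replace ((x + 2) / (x + 1) - 1) with (/ (x + 1)) in H by (field; lra). exact H.
Qed.

(** For k = j + 2 the bounds leave an error of at most 1/(j+1) - 1/(j+3) = 2/((j+1)(j+3)), and j + 3
    <= 3 (j+1) turns this into 6/(j+3)^2; the case j = 0 of this comparison is an equality. *)
Lemma log_step_approx k : Rabs (log_step k - / (INR k + 1)) <= 6 / (INR k + 1) ^ 2.
Proof.
  destruct k as [|[|k]].
  - unfold log_step; simpl. rewrite Rminus_diag. apply Rabs_le. lra.
  - unfold log_step; simpl. rewrite ln_1, ln_0. apply Rabs_le. lra.
  - pose proof (log_step_bounds k) as [H1 H2]. rewrite !S_INR.
    pose proof (pos_INR k) as Hx. set (x := INR k) in *.
    assert (/ (x + 1) - / (x + 1 + 1 + 1) <= 6 / (x + 1 + 1 + 1) ^ 2).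
    { apply Rminus_le.
      replace (/ (x + 1) - / (x + 1 + 1 + 1) - 6 / (x + 1 + 1 + 1) ^ 2)
        with (- (4 * x * / ((x + 1) * (x + 3) ^ 2))) by (field; lra).
      assert (0 < / ((x + 1) * (x + 3) ^ 2)).
      { apply Rinv_0_lt_compat, Rmult_lt_0_compat; [lra|apply pow_lt; lra]. }
      nra. }
    assert (/ (x + 1 + 1 + 1) <= / (x + 2)) by (apply Rinv_le_contravar; lra).
    assert (0 < 6 / (x + 1 + 1 + 1) ^ 2) by (apply Rdiv_lt_0_compat, pow_lt; lra).
    apply Rabs_le. lra.
Qed.

Lemma log_step_le k : Rabs (log_step k) <= 7 / (INR k + 1).
Proof.
  pose proof (log_step_approx k) as H. pose proof (pos_INR k) as Hx.
  pose proof (Rabs_triang (log_step k - / (INR k + 1)) (/ (INR k + 1))) as H1.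
  replace (log_step k - / (INR k + 1) + / (INR k + 1)) with (log_step k) in H1 by ring.
  assert (0 < / (INR k + 1)) by (apply Rinv_0_lt_compat; lra).
  rewrite (Rabs_right (/ _)) in H1 by lra.
  assert (/ (INR k + 1) <= 1).
  { rewrite <- Rinv_1. apply Rinv_le_contravar; lra. }
  assert (6 / (INR k + 1) ^ 2 <= 6 / (INR k + 1)).
  { replace (6 / (INR k + 1) ^ 2) with (6 * / (INR k + 1) * / (INR k + 1)) by (field; lra).
    unfold Rdiv. nra. }
  unfold Rdiv in *. lra.
Qed.

(* A quantitative form of [w] not being a pole of Gamma, stable under small
   perturbations of [w]. *)
Definition pole_free (d : R) (w : C) : Prop :=
  forall k, d * (INR k + 1) <= Cmod (w + INR k)%C.

Lemma pole_free_ex (w : C) : (forall k, (w + INR k)%C <> 0%C) ->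
  exists d, 0 < d /\ pole_free d w.
Proof.
  intros Hw.
  assert (Hfin : forall N, exists d, 0 < d <= 1 / 2 /\
             forall k, (k < N)%nat -> d * (INR k + 1) <= Cmod (w + INR k)%C).
  { induction N as [|N [d [Hd IH]]].
    - exists (1 / 2). split; [lra|]. intros; lia.
    - pose proof (pos_INR N) as HN.
      assert (HC : 0 < Cmod (w + INR N)%C) by (apply Cmod_gt_0, Hw).
      set (c := Cmod (w + INR N)%C / (INR N + 1)).
      assert (Hc : 0 < c) by (apply Rdiv_lt_0_compat; lra).
      exists (Rmin d c). pose proof (Rmin_l d c). pose proof (Rmin_r d c). split.
      + split; [apply Rmin_pos|]; lra.
      + intros k Hk. pose proof (pos_INR k). destruct (Nat.eq_dec k N) as [->|Hne].
        * replace (Cmod (w + INR N)%C) with (c * (INR N + 1)) by (unfold c; field; lra).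
          apply Rmult_le_compat_r; lra.
        * specialize (IH k ltac:(lia)). eapply Rle_trans; [|exact IH].
          apply Rmult_le_compat_r; lra. }
  (* For k > 2|w| + 1 one has |w+k| >= k - |w| >= (k+1)/2, whence the restriction d <= 1/2 above;
     only finitely many k remain. *)
  destruct (INR_unbounded (2 * Cmod w + 1)) as [N HN].
  destruct (Hfin N) as [d [Hd Hs]]. exists d. split; [lra|]. intros k.
  destruct (Nat.lt_ge_cases k N) as [Hk|Hk]; [auto|].
  apply le_INR in Hk. pose proof (Cmod_triangle_minus (INR k) (- w)%C) as H.
  replace (- w - INR k)%C with (- (w + INR k))%C in H by ring.
  rewrite !Cmod_opp, Cmod_R, Rabs_right in H by (apply Rle_ge, pos_INR).
  pose proof (Cmod_ge_0 w). nra.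
Qed.

Lemma pole_free_neq d w k : 0 < d -> pole_free d w -> (w + INR k)%C <> 0%C.
Proof.
  intros Hd H. apply Cmod_gt_0. specialize (H k). pose proof (pos_INR k). nra.
Qed.

Lemma pole_free_near d z h : 0 < d -> pole_free d z -> Cmod h <= d / 2 ->
  pole_free (d / 2) (z + h)%C.
Proof.
  intros Hd H Hh k. specialize (H k). pose proof (pos_INR k).
  pose proof (Cmod_triangle_minus (z + INR k)%C (z + h + INR k)%C) as H1.
  replace (z + h + INR k - (z + INR k))%C with h in H1 by ring. nra.
Qed.

Lemma pole_free_le d d' z : d' <= d -> pole_free d z -> pole_free d' z.
Proof. intros Hd H k. specialize (H k). pose proof (pos_INR k). nra. Qed.

Lemma pole_free_inv d w k : 0 < d -> pole_free d w ->
  Cmod (/ (w + INR k))%C <= / d * / (INR k + 1).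
Proof.
  intros Hd H. rewrite Cmod_inv by (eapply pole_free_neq; eauto).
  pose proof (pos_INR k). rewrite <- Rinv_mult.
  apply Rinv_le_contravar; [nra|apply H].
Qed.

Lemma pochhammer_Cprod x n : pochhammer x n = Cprod (fun k => x + INR k)%C n.
Proof. induction n; simpl; [reflexivity|now rewrite IHn]. Qed.

(** The k-th factor of [Gamma_seq (z + h) n / Gamma_seq z n]. For large k the quotient alone is
    about 1 - h/k, which gives no absolutely convergent product; the exponential cancels the h/k and
    leaves 1 + O(|h|/k^2). *)
Definition Gamma_factor (z h : C) (k : nat) : C :=
  (Cexp (h * log_step k) * ((z + INR k) / (z + h + INR k)))%C.

Lemma Cprod_Cexp (h : C) (f : nat -> R) n :
  Cprod (fun k => Cexp (h * f k)) n = Cexp (h * Rsum f n)%C.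
Proof.
  induction n; simpl.
  - rewrite Cmult_0_r. symmetry; apply Cexp_0.
  - rewrite IHn, <- Cexp_plus, RtoC_plus. f_equal. ring.
Qed.

Lemma RtoC_neq_0 x : x <> 0 -> RtoC x <> 0%C.
Proof. intros H E. apply H. now apply RtoC_inj. Qed.

Lemma Gamma_seq_neq_0 z n : (forall k, (z + INR k)%C <> 0%C) -> Gamma_seq z n <> 0%C.
Proof.
  intros Hz. unfold Gamma_seq. rewrite pochhammer_Cprod.
  apply Cmult_neq_0; [apply Cmult_neq_0|].
  - apply RtoC_neq_0, not_0_INR, fact_neq_0.
  - apply Cexp_neq_0.
  - intros E. apply (C1_nz). rewrite <- (Cinv_r (Cprod (fun k => z + INR k)%C (S n))).
    + rewrite E. ring.
    + apply Cprod_neq_0; auto.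
Qed.

Lemma Gamma_seq_ratio z h n :
  (forall k, (z + INR k)%C <> 0%C) -> (forall k, (z + h + INR k)%C <> 0%C) ->
  Gamma_seq (z + h)%C n = (Gamma_seq z n * Cprod (Gamma_factor z h) (S n))%C.
Proof.
  intros Hz Hzh. unfold Gamma_factor. rewrite Cprod_mult.
  unfold Cdiv. rewrite Cprod_mult, Cprod_inv by auto.
  rewrite Cprod_Cexp, Rsum_log_step. unfold Gamma_seq. rewrite !pochhammer_Cprod.
  rewrite Cmult_plus_distr_r, Cexp_plus. field.
  split; apply Cprod_neq_0; auto.
Qed.

(** Both [log_step k] and 1/(z+k) are compared with 1/(k+1); the second difference is
    (z-1)/((z+k)(k+1)). *)
Lemma Cmod_digamma_term d z k : 0 < d -> pole_free d z ->
  Cmod (log_step k - / (z + INR k))%C <= (6 + Cmod (z - 1)%C / d) * / (INR k + 1) ^ 2.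
Proof.
  intros Hd Hz. pose proof (pos_INR k) as Hk.
  assert (Hk1 : RtoC (INR k + 1) <> 0%C) by (apply RtoC_neq_0; lra).
  replace (log_step k - / (z + INR k))%C with
    (RtoC (log_step k - / (INR k + 1)) + (z - 1) * / (z + INR k) * RtoC (/ (INR k + 1)))%C.
  2:{ rewrite RtoC_minus, RtoC_inv by lra. rewrite RtoC_plus in *. field. split; auto.
      eapply pole_free_neq; eauto. }
  eapply Rle_trans; [apply Cmod_triangle|]. rewrite !Cmod_mult, !Cmod_R.
  assert (Hi : 0 < / (INR k + 1)) by (apply Rinv_0_lt_compat; lra).
  rewrite (Rabs_right (/ _)) by lra.
  pose proof (log_step_approx k). pose proof (pole_free_inv d z k Hd Hz) as H1.
  assert (Cmod (z - 1)%C * Cmod (/ (z + INR k))%C * / (INR k + 1) <=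
          Cmod (z - 1)%C / d * / (INR k + 1) ^ 2).
  { replace (Cmod (z - 1)%C / d * / (INR k + 1) ^ 2) with
      (Cmod (z - 1)%C * (/ d * / (INR k + 1)) * / (INR k + 1)) by (field; lra).
    apply Rmult_le_compat_r; [lra|]. apply Rmult_le_compat_l; [apply Cmod_ge_0|auto]. }
  unfold Rdiv in *. lra.
Qed.

Lemma Gamma_factor_expansion d H z h k :
  0 < d -> pole_free d z -> pole_free d (z + h)%C -> Cmod h <= H ->
  Cmod (Gamma_factor z h k - 1 - h * (log_step k - / (z + INR k)))%C <=
  (245 * exp (7 * H) * (1 + H / d) + 7 / d + / d ^ 2) * Cmod h ^ 2 * / (INR k + 1) ^ 2.
Proof.
  intros Hd Hz Hzh Hh. pose proof (pos_INR k) as Hk.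
  pose proof (pole_free_neq d z k Hd Hz) as Nz.
  pose proof (pole_free_neq d _ k Hd Hzh) as Nzh.
  pose proof (pole_free_inv d z k Hd Hz) as Iz.
  pose proof (pole_free_inv d _ k Hd Hzh) as Izh.
  assert (Hi : 0 < / (INR k + 1)) by (apply Rinv_0_lt_compat; lra).
  assert (Hi1 : / (INR k + 1) <= 1) by (rewrite <- Rinv_1; apply Rinv_le_contravar; lra).
  pose proof (log_step_le k) as Hl. unfold Rdiv in Hl.
  pose proof (Cmod_ge_0 h) as Hh0.
  set (x := (h * log_step k)%C).
  assert (Hx : Cmod x <= 7 * (Cmod h * / (INR k + 1))).
  { unfold x. rewrite Cmod_mult, Cmod_R. nra. }
  assert (Hx' : Cmod x <= 7 * H) by nra.
  unfold Gamma_factor. fold x.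
  (* Writing (z+k)/(z+h+k) = 1 - h/(z+h+k) isolates three second-order terms. They give in turn 245
     = 5 * 7^2 (the exponential remainder at |x| <= 7|h|/(k+1)), 7/d and 1/d^2. *)
  replace (Cexp x * ((z + INR k) / (z + h + INR k)) - 1 - h * (log_step k - / (z + INR k)))%C
    with ((Cexp x - 1 - x) * (1 - h * / (z + h + INR k)) + - (x * h * / (z + h + INR k))
          + h ^ 2 * (/ (z + INR k) * / (z + h + INR k)))%C.
  2:{ unfold x. field. auto. }
  set (i := / (INR k + 1)) in *.
  replace (/ (INR k + 1) ^ 2) with (i ^ 2) by (unfold i; field; lra).
  assert (Hid : 0 < / d) by (apply Rinv_0_lt_compat; lra).
  replace (/ d ^ 2) with (/ d * / d) by (field; lra). unfold Rdiv.
  set (j := / d) in *. set (m := Cmod h) in *.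
  eapply Rle_trans; [apply Cmod_triangle|].
  eapply Rle_trans; [apply Rplus_le_compat_r, Cmod_triangle|].
  rewrite Cmod_opp, !Cmod_mult, Cmod_pow. fold m.
  set (iz := Cmod (/ (z + INR k))%C) in *. set (izh := Cmod (/ (z + h + INR k))%C) in *.
  assert (0 <= iz) by apply Cmod_ge_0. assert (0 <= izh) by apply Cmod_ge_0.
  pose proof (Cmod_ge_0 x) as Hx0.
  assert (HH : 0 <= H) by lra.
  assert (T1 : Cmod (Cexp x - 1 - x)%C <= 245 * exp (7 * H) * (m ^ 2 * i ^ 2)).
  { eapply Rle_trans; [apply (Cmod_Cexp_minus x (7 * H)), Hx'|].
    assert (Cmod x ^ 2 <= 49 * (m ^ 2 * i ^ 2)).
    { replace (49 * (m ^ 2 * i ^ 2)) with ((7 * (m * i)) ^ 2) by ring. apply pow_incr; lra. }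
    pose proof (exp_pos (7 * H)). nra. }
  assert (T2 : Cmod (1 - h * / (z + h + INR k))%C <= 1 + H * j).
  { eapply Rle_trans; [apply Cmod_triangle|]. rewrite Cmod_opp, Cmod_mult, Cmod_1.
    fold m izh. assert (j * i <= j) by nra. nra. }
  assert (T3 : Cmod (Cexp x - 1 - x)%C * Cmod (1 - h * / (z + h + INR k))%C <=
               245 * exp (7 * H) * (m ^ 2 * i ^ 2) * (1 + H * j)).
  { apply Rmult_le_compat; auto using Cmod_ge_0. }
  assert (T4 : Cmod x * m * izh <= 7 * (m * i) * m * (j * i)).
  { apply Rmult_le_compat; auto. nra. apply Rmult_le_compat_r; auto. }
  assert (T5 : m ^ 2 * (iz * izh) <= m ^ 2 * ((j * i) * (j * i))).
  { apply Rmult_le_compat_l; [apply pow2_ge_0|]. apply Rmult_le_compat; auto. }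
  eapply Rle_trans; [apply Rplus_le_compat; [apply Rplus_le_compat; [exact T3|exact T4]|exact T5]|].
  right. ring.
Qed.

Section Expansion.
Variables (d H : R) (z : C).
Hypothesis (Hd : 0 < d) (HH : 0 <= H) (Hz : pole_free d z).

Let K := 245 * exp (7 * H) * (1 + H / d) + 7 / d + / d ^ 2.
Let D := 6 + Cmod (z - 1)%C / d.

Let K_ge_0 : 0 <= K.
Proof.
  unfold K. pose proof (exp_pos (7 * H)).
  assert (0 < / d) by (apply Rinv_0_lt_compat; lra).
  assert (0 < / d ^ 2) by (apply Rinv_0_lt_compat, pow_lt; lra).
  unfold Rdiv. assert (0 <= H * / d) by nra. nra.
Qed.

Let D_ge_0 : 0 <= D.
Proof.
  unfold D. pose proof (Cmod_ge_0 (z - 1)%C).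
  assert (0 < / d) by (apply Rinv_0_lt_compat; lra). unfold Rdiv. nra.
Qed.

Lemma Cmod_Gamma_factor_minus_1 h k : pole_free d (z + h)%C -> Cmod h <= H ->
  Cmod (Gamma_factor z h k - 1)%C <= (D + K * H) * Cmod h * / (INR k + 1) ^ 2.
Proof.
  intros Hzh Hh. pose proof (pos_INR k). pose proof (Cmod_ge_0 h).
  assert (Hi : 0 < / (INR k + 1) ^ 2) by (apply Rinv_0_lt_compat, pow_lt; lra).
  replace (Gamma_factor z h k - 1)%C with
    ((Gamma_factor z h k - 1 - h * (log_step k - / (z + INR k)))
     + h * (log_step k - / (z + INR k)))%C by ring.
  eapply Rle_trans; [apply Cmod_triangle|]. rewrite (Cmod_mult h).
  pose proof (Gamma_factor_expansion d H z h k Hd Hz Hzh Hh) as G1. fold K in G1.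
  pose proof (Cmod_digamma_term d z k Hd Hz) as G2. fold D in G2.
  set (i := / (INR k + 1) ^ 2) in *. set (m := Cmod h) in *.
  assert (m * Cmod (log_step k - / (z + INR k))%C <= m * (D * i)).
  { apply Rmult_le_compat_l; auto. }
  assert (K * m ^ 2 * i <= K * H * m * i).
  { apply Rmult_le_compat_r; [lra|]. assert (m * m <= H * m) by nra. simpl. nra. }
  lra.
Qed.

Lemma Rsum_scaled_inv_sq_le c n : 0 <= c ->
  Rsum (fun k => c * / (INR k + 1) ^ 2) n <= 2 * c.
Proof. intros Hc. rewrite Rsum_scal. pose proof (Rsum_inv_sq_le n). nra. Qed.

Lemma Gamma_factor_eq (h : C) n :
  Cprod (Gamma_factor z h) n = Cprod (fun k => 1 + (Gamma_factor z h k - 1))%C n.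
Proof. apply Cprod_ext. intros k _. ring. Qed.

Lemma Cprod_Gamma_factor_cv h : pole_free d (z + h)%C -> Cmod h <= H ->
  exists l : C, filterlim (Cprod (Gamma_factor z h)) eventually (locally l).
Proof.
  intros Hzh Hh.
  destruct (Cprod_cv (fun k => Gamma_factor z h k - 1)%C
              (fun k => (D + K * H) * Cmod h * / (INR k + 1) ^ 2)
              (fun k => Cmod_Gamma_factor_minus_1 h k Hzh Hh)
              (2 * ((D + K * H) * Cmod h))) as [l Hl].
  - intros n. apply Rsum_scaled_inv_sq_le. pose proof (Cmod_ge_0 h).
    apply Rmult_le_pos; auto. pose proof (Rmult_le_pos _ _ K_ge_0 HH). lra.
  - exists l. eapply filterlim_ext; [|exact Hl]. intros n; symmetry; apply Gamma_factor_eq.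
Qed.

(** The point is the order of quantifiers: M serves every h and every n, so the inequality can be
    carried to the limit in n. *)
Lemma Cprod_Gamma_factor_expansion : exists M, forall h n,
  pole_free d (z + h)%C -> Cmod h <= H ->
  Cmod (Cprod (Gamma_factor z h) n - 1 - h * Csum (fun k => log_step k - / (z + INR k)) n)%C
  <= M * Cmod h ^ 2.
Proof.
  set (c := D + K * H).
  assert (Hc : 0 <= c) by (unfold c; pose proof (Rmult_le_pos _ _ K_ge_0 HH); lra).
  (* The factors differ from 1 by a total of at most 2c|h|, which gives the first summand through
     the second-order product bound; 2K sums the remainders of the single factors. *)
  exists (4 * c ^ 2 * exp (2 * c * H) + 2 * K). intros h n Hzh Hh.
  set (a := fun k => (Gamma_factor z h k - 1)%C).
  rewrite Gamma_factor_eq. change (fun k => 1 + (Gamma_factor z h k - 1))%C with (fun k => 1 + a k)%C.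
  pose proof (Cmod_ge_0 h) as Hh0.
  set (e := fun k => c * Cmod h * / (INR k + 1) ^ 2).
  assert (Ha : forall k, Cmod (a k) <= e k).
  { intros k. exact (Cmod_Gamma_factor_minus_1 h k Hzh Hh). }
  pose proof (Cprod_second_order a e Ha n) as H1.
  assert (HS : Rsum e n <= 2 * (c * Cmod h)) by (apply Rsum_scaled_inv_sq_le; nra).
  assert (HS0 : 0 <= Rsum e n).
  { apply Rsum_ge_0. intros k. eapply Rle_trans; [apply Cmod_ge_0|apply Ha]. }
  replace (Cprod (fun k => 1 + a k) n - 1 - h * Csum (fun k => log_step k - / (z + INR k)) n)%C
    with ((Cprod (fun k => 1 + a k) n - 1 - Csum a n)
          + Csum (fun k => a k + - h * (log_step k - / (z + INR k))) n)%C.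
  2:{ rewrite Csum_plus, Csum_scal. ring. }
  eapply Rle_trans; [apply Cmod_triangle|]. rewrite Rmult_plus_distr_r.
  apply Rplus_le_compat.
  - eapply Rle_trans; [exact H1|].
    replace (4 * c ^ 2 * exp (2 * c * H) * Cmod h ^ 2)
      with ((2 * (c * Cmod h)) ^ 2 * exp (2 * c * H)) by ring.
    apply Rmult_le_compat; [apply pow2_ge_0|left; apply exp_pos|apply pow_incr; lra|].
    apply exp_le_compat. nra.
  - rewrite Rmult_assoc.
    apply Cmod_Csum_le with (e := fun k => K * Cmod h ^ 2 * / (INR k + 1) ^ 2).
    + intros k. pose proof (Gamma_factor_expansion d H z h k Hd Hz Hzh Hh) as H2.
      fold K in H2. unfold a.
      replace (Gamma_factor z h k - 1 + - h * (log_step k - / (z + INR k)))%C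
       with (Gamma_factor z h k - 1 - h * (log_step k - / (z + INR k)))%C by ring. exact H2.
    + intros m. apply Rsum_scaled_inv_sq_le. pose proof (pow2_ge_0 (Cmod h)). nra.
Qed.

Lemma digamma_series_cv :
  exists l : C, filterlim (Csum (fun k => log_step k - / (z + INR k))%C) eventually (locally l).
Proof.
  apply Csum_abs_cv with (e := fun k => D * / (INR k + 1) ^ 2) (B := 2 * D).
  - intros k. apply Cmod_digamma_term; auto.
  - intros n. apply Rsum_scaled_inv_sq_le, D_ge_0.
Qed.

End Expansion.

Lemma Cprod_Gamma_factor_cv_ex z h :
  (forall k, (z + INR k)%C <> 0%C) -> (forall k, (z + h + INR k)%C <> 0%C) ->
  exists l : C, filterlim (Cprod (Gamma_factor z h)) eventually (locally l).
Proof.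
  intros Hz Hzh.
  destruct (pole_free_ex _ Hz) as [d1 [Hd1 P1]].
  destruct (pole_free_ex _ Hzh) as [d2 [Hd2 P2]].
  pose proof (Rmin_l d1 d2). pose proof (Rmin_r d1 d2).
  apply (Cprod_Gamma_factor_cv (Rmin d1 d2) (Cmod h)).
  - apply Rmin_pos; auto.
  - apply Cmod_ge_0.
  - apply (pole_free_le d1); auto.
  - apply (pole_free_le d2); auto.
  - lra.
Qed.

Lemma Cexp_ln x : 0 < x -> Cexp (ln x) = RtoC x.
Proof.
  intros Hx. unfold Cexp; simpl. rewrite exp_ln, cos_0, sin_0 by auto.
  unfold RtoC. f_equal; ring.
Qed.

Lemma Clim_inv_INR : filterlim (fun n => RtoC (/ INR (S n))) eventually (locally (RtoC 0)).
Proof.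
  apply filterlim_Cmod; [typeclasses eauto|]. intros eps He.
  destruct (archimed_cor1 eps He) as [N [HN HN0]]. exists N. intros n Hn.
  replace (RtoC (/ INR (S n)) - 0)%C with (RtoC (/ INR (S n))) by ring.
  apply lt_INR in HN0 as HN1. simpl in HN1.
  assert (INR N <= INR (S n)) by (apply le_INR; lia).
  rewrite Cmod_R, Rabs_right by (left; apply Rinv_0_lt_compat; lra).
  eapply Rle_lt_trans; [|exact HN]. apply Rinv_le_contravar; lra.
Qed.

Lemma pochhammer_1 n : pochhammer 1 n = RtoC (INR (fact n)).
Proof.
  induction n; [reflexivity|]. simpl pochhammer. rewrite IHn.
  rewrite fact_simpl, mult_INR, S_INR, RtoC_mult, RtoC_plus. ring.
Qed.

Lemma Gamma_seq_1_cv : filterlim (Gamma_seq 1) eventually (locally (RtoC 1)).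
Proof.
  apply filterlim_ext_loc with (f := fun n => (1 - RtoC (/ INR (S n)))%C).
  (* [Gamma_seq 1 n] is n/(n+1) only from n = 1 on: at n = 0 the convention ln 0 = 0 gives the power
     the value 1. *)
  - exists 1%nat. intros n Hn. apply le_INR in Hn. simpl in Hn.
    unfold Gamma_seq. rewrite pochhammer_1, Cmult_1_l, Cexp_ln by lra.
    rewrite fact_simpl, mult_INR, S_INR, RtoC_mult, RtoC_inv, RtoC_plus by lra.
    field. split.
    + apply RtoC_neq_0, not_0_INR, fact_neq_0.
    + rewrite <- RtoC_plus. apply RtoC_neq_0. lra.
  - pose proof (Clim_minus eventually (fun _ => RtoC 1) _ 1 0 (filterlim_const _) Clim_inv_INR)
      as H.
    replace (1 - 0)%C with (RtoC 1) in H by ring. exact H.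
Qed.

Lemma filterlim_succ {T : Type} (f : nat -> T) (G : (T -> Prop) -> Prop) :
  filterlim f eventually G -> filterlim (fun n => f (S n)) eventually G.
Proof.
  intros H. eapply filterlim_comp; [|exact H].
  intros P [N HN]. exists N. intros n Hn. apply HN. lia.
Qed.

Lemma Gamma_of_lim z (l : C) :
  filterlim (Gamma_seq z) eventually (locally l) -> Gamma z = l.
Proof.
  intros H. pose proof (proj1 (filterlim_Cmod eventually _ _) H) as H'.
  unfold Gamma. rewrite (is_lim_seq_unique _ (Re l)), (is_lim_seq_unique _ (Im l)).
  - destruct l; reflexivity.
  - apply is_lim_seq_spec. intros eps. specialize (H' eps (cond_pos eps)).
    destruct H' as [N HN]. exists N. intros n Hn.
    eapply Rle_lt_trans; [|exact (HN n Hn)].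
    eapply Rle_trans; [|apply im_le_Cmod]. right. reflexivity.
  - apply is_lim_seq_spec. intros eps. specialize (H' eps (cond_pos eps)).
    destruct H' as [N HN]. exists N. intros n Hn.
    eapply Rle_lt_trans; [|exact (HN n Hn)].
    eapply Rle_trans; [|apply re_le_Cmod]. right. reflexivity.
Qed.

Lemma one_plus_INR_neq_0 k : (1 + INR k)%C <> 0%C.
Proof. rewrite <- RtoC_plus. apply RtoC_neq_0. pose proof (pos_INR k). lra. Qed.

(* Both [Gamma_seq z / Gamma_seq 1] and its inverse are convergent products, so
   the limit is nonzero. *)
Lemma Gamma_cv z : (forall k, (z + INR k)%C <> 0%C) ->
  filterlim (Gamma_seq z) eventually (locally (Gamma z)) /\ Gamma z <> 0%C.
Proof.
  intros Hz.
  assert (E1 : (1 + (z - 1))%C = z) by ring. assert (E2 : (z + (1 - z))%C = RtoC 1) by ring.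
  destruct (Cprod_Gamma_factor_cv_ex 1 (z - 1)) as [l1 Hl1];
    [apply one_plus_INR_neq_0 | now rewrite E1 |].
  destruct (Cprod_Gamma_factor_cv_ex z (1 - z)) as [l2 Hl2];
    [auto | rewrite E2; apply one_plus_INR_neq_0 |].
  assert (HG : filterlim (Gamma_seq z) eventually (locally l1)).
  { rewrite <- (Cmult_1_l l1).
    eapply filterlim_ext;
      [|apply (Clim_mult eventually); [exact Gamma_seq_1_cv | apply filterlim_succ, Hl1]].
    intros n. cbv beta. rewrite <- Gamma_seq_ratio, E1; auto.
    apply one_plus_INR_neq_0. now rewrite E1. }
  assert (HL : (l1 * l2)%C = RtoC 1).
  { eapply (Clim_unique eventually); [|exact Gamma_seq_1_cv].
    eapply filterlim_ext;
      [|apply (Clim_mult eventually); [exact HG | apply filterlim_succ, Hl2]].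
    intros n. cbv beta. rewrite <- Gamma_seq_ratio, E2; auto.
    rewrite E2. apply one_plus_INR_neq_0. }
  rewrite (Gamma_of_lim z l1 HG). split; auto.
  intros E. apply C1_nz. rewrite <- HL, E. ring.
Qed.

(** An explicit quadratic remainder on a fixed disc is stable under pointwise limits of f and L,
    unlike the little-o definition of the derivative. Both differentiations below go through it. *)
Lemma is_derive_of_quadratic_bound (f : C -> C) (z L : C) (M eta : R) :
  0 < eta ->
  (forall h, Cmod h <= eta -> Cmod (f (z + h) - f z - h * L)%C <= M * Cmod h ^ 2) ->
  is_derive f z L.
Proof.
  intros Heta H. split; [apply is_linear_scal_l|].
  intros x Hx. pose proof (@is_filter_lim_locally_unique C_AbsRing (AbsRing_NormedModule C_AbsRing) z x Hx) as Ex.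
  subst x. intros eps.
  assert (HM : 0 < Rabs M + 1) by (pose proof (Rabs_pos M); lra).
  assert (Hr : 0 < Rmin eta (eps / (Rabs M + 1))).
  { apply Rmin_pos; auto. apply Rdiv_lt_0_compat; auto. apply cond_pos. }
  exists (mkposreal _ Hr). revert Hr.
  enough (HC : forall y : C, Cmod (y - z)%C < Rmin eta (eps / (Rabs M + 1)) ->
            Cmod (f y - f z - (y - z) * L)%C <= eps * Cmod (y - z)%C) by (intros Hr; exact HC).
  intros y Hy. specialize (H (y - z)%C).
  replace (z + (y - z))%C with y in H by ring.
  pose proof (Rmin_l eta (eps / (Rabs M + 1))). pose proof (Rmin_r eta (eps / (Rabs M + 1))).
  eapply Rle_trans; [apply H; lra|]. simpl. rewrite Rmult_1_r, <- Rmult_assoc.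
  pose proof (Cmod_ge_0 (y - z)%C). apply Rmult_le_compat_r; auto.
  apply Rle_trans with ((Rabs M + 1) * (eps / (Rabs M + 1))).
  - pose proof (Rle_abs M).
    assert (M * Cmod (y - z)%C <= (Rabs M + 1) * Cmod (y - z)%C) by nra.
    assert ((Rabs M + 1) * Cmod (y - z)%C <= (Rabs M + 1) * (eps / (Rabs M + 1))).
    { apply Rmult_le_compat_l; lra. }
    lra.
  - right. field. lra.
Qed.

(** The expansion of [Gamma_seq (z + h) n / Gamma_seq z n] is uniform in n, so n may tend to
    infinity at fixed h. Radius and separation are both d/2, so that z+h stays as far from the poles
    as the expansion demands. *)
Lemma is_derive_Gamma z : (forall k, (z + INR k)%C <> 0%C) ->
  exists l : C,
    filterlim (Csum (fun k => log_step k - / (z + INR k))%C) eventually (locally l) /\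
    is_derive Gamma z (Gamma z * l)%C.
Proof.
  intros Hz. destruct (pole_free_ex z Hz) as [d [Hd P]].
  destruct (digamma_series_cv d z Hd P) as [l Hl]. exists l. split; auto.
  assert (Hd2 : 0 < d / 2) by lra.
  assert (P2 : pole_free (d / 2) z) by (apply (pole_free_le d); auto; lra).
  destruct (Cprod_Gamma_factor_expansion (d / 2) (d / 2) z Hd2 (Rlt_le _ _ Hd2) P2) as [M HM].
  apply (is_derive_of_quadratic_bound _ _ _ (Cmod (Gamma z) * M) (d / 2)); auto.
  intros h Hh.
  pose proof (pole_free_near d z h Hd P Hh) as Ph.
  assert (Hzh : forall k, (z + h + INR k)%C <> 0%C).
  { intros k. apply (pole_free_neq (d / 2)); auto. }
  destruct (Gamma_cv z Hz) as [G1 G2]. destruct (Gamma_cv _ Hzh) as [G3 _].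
  rewrite Rmult_assoc.
  replace (Gamma (z + h) - Gamma z - h * (Gamma z * l))%C with
    (Gamma z * (Gamma (z + h) / Gamma z - 1 - h * l))%C by (field; auto).
  rewrite Cmod_mult. apply Rmult_le_compat_l; [apply Cmod_ge_0|].
  apply (Clim_le eventually (fun n => Gamma_seq (z + h) n / Gamma_seq z n - 1
            - h * Csum (fun k => log_step k - / (z + INR k)) (S n))%C).
  - exists 0%nat. intros n _. specialize (HM h (S n) Ph Hh).
    rewrite (Gamma_seq_ratio z h n Hz Hzh).
    replace (Gamma_seq z n * Cprod (Gamma_factor z h) (S n) / Gamma_seq z n)%C
      with (Cprod (Gamma_factor z h) (S n)) by (field; apply Gamma_seq_neq_0, Hz).
    exact HM.
  - apply (Clim_minus eventually).
    + apply (Clim_minus eventually); [|apply filterlim_const].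
      apply (Clim_div eventually); auto.
    + apply (Clim_mult eventually); [apply filterlim_const|]. apply filterlim_succ, Hl.
Qed.

(** * Series for the digamma function and its derivative *)

Definition digamma (z : C) : C := (C_derive Gamma z / Gamma z)%C.

(** Since the steps telescope, this is the classical psi(z) = lim (ln n - sum_{k<=n} 1/(z+k)). *)
Lemma digamma_cv z : (forall k, (z + INR k)%C <> 0%C) ->
  filterlim (Csum (fun k => log_step k - / (z + INR k))%C) eventually (locally (digamma z)).
Proof.
  intros Hz. destruct (is_derive_Gamma z Hz) as [l [Hl Hder]].
  unfold digamma. rewrite (is_C_derive_unique _ _ _ Hder).
  replace (Gamma z * l / Gamma z)%C with l; auto.
  field. apply Gamma_cv, Hz.
Qed.

Lemma Csum_minus f g n : Csum (fun k => f k - g k)%C n = (Csum f n - Csum g n)%C.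
Proof. induction n; simpl; [ring|rewrite IHn; ring]. Qed.

(** In the difference of two digamma series the logarithmic steps cancel, and the remainder after
    the linear term is the sum of -h^2/((z+k)^2 (z+h+k)), again bounded uniformly in the
    truncation. *)
Lemma polygamma_1_cv z : (forall k, (z + INR k)%C <> 0%C) ->
  filterlim (Csum (fun k => / (z + INR k) ^ 2)%C) eventually (locally (polygamma 1 z)).
Proof.
  intros Hz. destruct (pole_free_ex z Hz) as [d [Hd P]].
  assert (Hid : 0 < / d) by (apply Rinv_0_lt_compat; lra).
  destruct (Csum_abs_cv (fun k => / (z + INR k) ^ 2)%C
              (fun k => / d ^ 2 * / (INR k + 1) ^ 2) (2 * / d ^ 2)) as [l Hl].
  { intros k. pose proof (pole_free_inv d z k Hd P) as H.
    rewrite Cmod_inv by (apply Cpow_nz, Hz). rewrite Cmod_pow.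
    rewrite Cmod_inv in H by apply Hz.
    rewrite <- !pow_inv, <- Rpow_mult_distr.
    apply pow_incr. split; [|exact H].
    left. apply Rinv_0_lt_compat, Cmod_gt_0, Hz. }
  { intros n. apply Rsum_scaled_inv_sq_le. left. apply Rinv_0_lt_compat, pow_lt; lra. }
  replace (polygamma 1 z) with l; auto.
  symmetry. unfold polygamma; simpl. apply is_C_derive_unique.
  change (is_derive digamma z l).
  (* The inner constant 2/d^3 combines 1/d^2 from z+k with 1/(d/2) from z+h+k; the outer 2 bounds
     the sum of the 1/(k+1)^2. *)
  apply (is_derive_of_quadratic_bound _ _ _ (2 * (2 * / d ^ 3)) (d / 2)); [lra|].
  intros h Hh. pose proof (pole_free_near d z h Hd P Hh) as Ph.
  assert (Hd2 : 0 < d / 2) by lra.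
  assert (Hzh : forall k, (z + h + INR k)%C <> 0%C).
  { intros k. apply (pole_free_neq (d / 2)); auto. }
  apply (Clim_le eventually (fun n =>
     Csum (fun k => log_step k - / (z + h + INR k)) n - Csum (fun k => log_step k - / (z + INR k)) n
            - h * Csum (fun k => / (z + INR k) ^ 2) n)%C).
  - exists 0%nat. intros n _. rewrite <- Csum_scal, <- !Csum_minus.
    apply Cmod_Csum_le with (e := fun k => (2 * / d ^ 3 * Cmod h ^ 2) * / (INR k + 1) ^ 2).
    + intros k.
      replace (log_step k - / (z + h + INR k) - (log_step k - / (z + INR k)) - h * / (z + INR k) ^ 2)%C
        with (- (h ^ 2 * (/ (z + INR k)) ^ 2 * / (z + h + INR k)))%C by (field; auto).
      rewrite Cmod_opp, !Cmod_mult, !Cmod_pow.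
      pose proof (pole_free_inv d z k Hd P) as H1.
      pose proof (pole_free_inv (d / 2) _ k Hd2 Ph) as H2.
      pose proof (pos_INR k) as Hk.
      assert (Hi : 0 < / (INR k + 1)) by (apply Rinv_0_lt_compat; lra).
      assert (Hi1 : / (INR k + 1) <= 1) by (rewrite <- Rinv_1; apply Rinv_le_contravar; lra).
      replace (2 * / d ^ 3 * Cmod h ^ 2 * / (INR k + 1) ^ 2) with
        (Cmod h ^ 2 * (/ d * / (INR k + 1)) ^ 2 * (/ (d / 2) * 1)) by (field; lra).
      apply Rmult_le_compat; auto using Cmod_ge_0.
      * apply Rmult_le_pos; apply pow2_ge_0.
      * apply Rmult_le_compat_l; [apply pow2_ge_0|]. apply pow_incr.
        split; [apply Cmod_ge_0|auto].
      * eapply Rle_trans; [exact H2|]. apply Rmult_le_compat_l; auto.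
        left; apply Rinv_0_lt_compat; lra.
    + intros m. rewrite (Rmult_assoc 2 (2 * / d ^ 3)). apply Rsum_scaled_inv_sq_le.
      assert (0 < / d ^ 3) by (apply Rinv_0_lt_compat, pow_lt; lra).
      pose proof (pow2_ge_0 (Cmod h)). apply Rmult_le_pos; lra.
  - apply (Clim_minus eventually).
    + apply (Clim_minus eventually); apply digamma_cv; auto.
    + apply (Clim_mult eventually); [apply filterlim_const|exact Hl].
Qed.

(** * A partial fraction expansion *)

Lemma Csum_shift f n : Csum f (S n) = (f O + Csum (fun k => f (S k)) n)%C.
Proof.
  induction n; [simpl; ring|].
  change (Csum f (S (S n))) with (Csum f (S n) + f (S n))%C. rewrite IHn. simpl. ring.
Qed.

Lemma Cprod_shift f n : Cprod f (S n) = (f O * Cprod (fun k => f (S k)) n)%C.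
Proof.
  induction n; [simpl; ring|].
  change (Cprod f (S (S n))) with (Cprod f (S n) * f (S n))%C. rewrite IHn. simpl. ring.
Qed.

Section PartialFractions.
Open Scope C_scope.
Variables (p q : nat -> C).
Hypothesis (Hq : forall m n, m <> n -> q m <> q n).

Definition pf_ratio (N : nat) (y : C) : C :=
  Cprod (fun k => p k - y) (S (S N)) / Cprod (fun m => q m - y) (S N).

(** The coefficient of 1/(q n - y). Replacing the vanishing factor by 1, rather than omitting it,
    keeps the product over all indices, so that passing from N to N+1 merely appends a factor. *)
Definition pf_coef (N n : nat) : C :=
  Cprod (fun k => p k - q n) (S (S N)) /
  Cprod (fun m => if Nat.eq_dec m n then 1 else q m - q n) (S N).

Lemma pf_coef_denom_neq_0 n N :
  Cprod (fun m => if Nat.eq_dec m n then 1 else q m - q n) N <> 0.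
Proof.
  apply Cprod_neq_0. intros m _. destruct (Nat.eq_dec m n); [apply C1_nz|].
  apply Cminus_eq_contra; auto.
Qed.

Lemma pf_coef_S N n : (n <= N)%nat ->
  pf_coef (S N) n = pf_coef N n * ((p (S (S N)) - q n) / (q (S N) - q n)).
Proof.
  intros Hn. unfold pf_coef.
  change (Cprod (fun k => p k - q n) (S (S (S N))))
    with (Cprod (fun k => p k - q n) (S (S N)) * (p (S (S N)) - q n)).
  change (Cprod (fun m => if Nat.eq_dec m n then 1 else q m - q n) (S (S N)))
    with (Cprod (fun m => if Nat.eq_dec m n then 1 else q m - q n) (S N) *
          (if Nat.eq_dec (S N) n then 1 else q (S N) - q n)).
  destruct (Nat.eq_dec (S N) n); [lia|]. field. split.
  - apply Cminus_eq_contra; auto.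
  - apply pf_coef_denom_neq_0.
Qed.

(** The coefficient at the new node involves the previous ratio evaluated at that node; the
    induction hypothesis, used there, makes this value explicit. *)
Lemma pf_coef_diag N :
  pf_coef (S N) (S N) = (p (S (S N)) - q (S N)) * pf_ratio N (q (S N)).
Proof.
  unfold pf_coef, pf_ratio.
  change (Cprod (fun k => p k - q (S N)) (S (S (S N))))
    with (Cprod (fun k => p k - q (S N)) (S (S N)) * (p (S (S N)) - q (S N))).
  change (Cprod (fun m => if Nat.eq_dec m (S N) then 1 else q m - q (S N)) (S (S N)))
    with (Cprod (fun m => if Nat.eq_dec m (S N) then 1 else q m - q (S N)) (S N) *
          (if Nat.eq_dec (S N) (S N) then 1 else q (S N) - q (S N))).
  destruct (Nat.eq_dec (S N) (S N)); [|lia].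
  rewrite (Cprod_ext (fun m => if Nat.eq_dec m (S N) then 1 else q m - q (S N))
             (fun m => q m - q (S N)) (S N)).
  - field. apply Cprod_neq_0. intros m Hm. apply Cminus_eq_contra, Hq. lia.
  - intros m Hm. destruct (Nat.eq_dec m (S N)); [lia|reflexivity].
Qed.

Lemma pf_ratio_S N y : (forall m, (m <= S N)%nat -> q m <> y) ->
  pf_ratio (S N) y = pf_ratio N y * ((p (S (S N)) - y) / (q (S N) - y)).
Proof.
  intros Hy. unfold pf_ratio.
  change (Cprod (fun k => p k - y) (S (S (S N))))
    with (Cprod (fun k => p k - y) (S (S N)) * (p (S (S N)) - y)).
  change (Cprod (fun m => q m - y) (S (S N)))
    with (Cprod (fun m => q m - y) (S N) * (q (S N) - y)).
  field. split.
  - apply Cminus_eq_contra; auto.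
  - apply Cprod_neq_0. intros m Hm. apply Cminus_eq_contra, Hy. lia.
Qed.

(** The numerator has degree one higher than the denominator, so the polynomial part is -y plus this
    constant; only the -1 survives differentiation. *)
Let pf_const (N : nat) : C := Csum p (S (S N)) - Csum q (S N).

(** Induction on the number of nodes. The old coefficients are multiplied by (p - q n)/(q - q n), p
    and q being the new zero and node; splitting this against 1/(q n - y) produces the old expansion
    at y and at q, so the hypothesis is needed at two points and y must be generalised. *)
Lemma partial_fractions N y : (forall m, (m <= N)%nat -> q m <> y) ->
  pf_ratio N y = - y + pf_const N + Csum (fun n => pf_coef N n / (q n - y)) (S N).
Proof.
  revert y. induction N as [|N IH]; intros y Hy.
  - unfold pf_ratio, pf_coef, pf_const; simpl. field.
    apply Cminus_eq_contra; auto.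
  - rewrite pf_ratio_S by auto.
    assert (Hyq : q (S N) - y <> 0) by (apply Cminus_eq_contra; auto).
    change (Csum (fun n => pf_coef (S N) n / (q n - y)) (S (S N)))
      with (Csum (fun n => pf_coef (S N) n / (q n - y)) (S N)
            + pf_coef (S N) (S N) / (q (S N) - y)).
    rewrite pf_coef_diag.
    rewrite (IH (q (S N))) by (intros m Hm; apply Hq; lia).
    rewrite (IH y) by (intros m Hm; apply Hy; lia).
    rewrite (Csum_ext (fun n => pf_coef (S N) n / (q n - y))
      (fun n => (p (S (S N)) - y) / (q (S N) - y) * (pf_coef N n / (q n - y)) -
                (p (S (S N)) - q (S N)) / (q (S N) - y) * (pf_coef N n / (q n - q (S N))))
      (S N)).
    + rewrite Csum_minus, !Csum_scal.
      set (S1 := Csum (fun n => pf_coef N n / (q n - y)) (S N)).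
      set (S2 := Csum (fun n => pf_coef N n / (q n - q (S N))) (S N)).
      unfold pf_const.
      change (Csum p (S (S (S N)))) with (Csum p (S (S N)) + p (S (S N))).
      change (Csum q (S (S N))) with (Csum q (S N) + q (S N)).
      field. auto.
    + intros n Hn. rewrite pf_coef_S by lia. field.
      repeat split; auto; apply Cminus_eq_contra; try (apply Hq; lia).
      apply Hy; lia.
Qed.

(* The derivative at [y = 0] of [partial_fractions]. *)
Lemma partial_fractions_deriv N :
  (forall k, p k <> 0) -> (forall m, q m <> 0) ->
  pf_ratio N 0 * (Csum (fun m => / q m) (S N) - Csum (fun k => / p k) (S (S N))) =
  - (1) + Csum (fun n => pf_coef N n / q n ^ 2) (S N).
Proof.
  intros Hp Hq0. induction N as [|N IH].
  - unfold pf_ratio, pf_coef; simpl. field. repeat split; auto.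
    replace (q 0%nat - 0) with (q 0%nat) by ring. auto.
  - rewrite pf_ratio_S by auto.
    change (Csum (fun m => / q m) (S (S N))) with (Csum (fun m => / q m) (S N) + / q (S N)).
    change (Csum (fun k => / p k) (S (S (S N))))
      with (Csum (fun k => / p k) (S (S N)) + / p (S (S N))).
    change (Csum (fun n => pf_coef (S N) n / q n ^ 2) (S (S N)))
      with (Csum (fun n => pf_coef (S N) n / q n ^ 2) (S N)
            + pf_coef (S N) (S N) / q (S N) ^ 2).
    rewrite pf_coef_diag.
    pose proof (partial_fractions N (q (S N)) ltac:(intros m Hm; apply Hq; lia)) as E1.
    pose proof (partial_fractions N 0 ltac:(auto)) as E0.
    rewrite E1.
    (* The derivative formula is proved by algebra instead of differentiation: (p - x)/((q - x) x^2)
       is split into partial fractions in x = q n. The parts in 1/x and 1/(x - q) are the expansions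
       [E0] and [E1], the part in 1/x^2 is the induction hypothesis. *)
    rewrite (Csum_ext (fun n => pf_coef (S N) n / q n ^ 2)
      (fun n => (p (S (S N)) / q (S N) * (pf_coef N n / q n ^ 2) +
                 (p (S (S N)) - q (S N)) / q (S N) ^ 2 * (pf_coef N n / (q n - 0))) -
                (p (S (S N)) - q (S N)) / q (S N) ^ 2 * (pf_coef N n / (q n - q (S N))))
      (S N)).
    + rewrite Csum_minus, Csum_plus, !Csum_scal.
      set (S0 := Csum (fun n => pf_coef N n / (q n - 0)) (S N)) in *.
      set (S1 := Csum (fun n => pf_coef N n / (q n - q (S N))) (S N)) in *.
      set (S2 := Csum (fun n => pf_coef N n / q n ^ 2) (S N)) in *.
      transitivity (p (S (S N)) / q (S N) * (- (1) + S2)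
                    + pf_ratio N 0 * (p (S (S N)) - q (S N)) / q (S N) ^ 2).
      * rewrite <- IH. field. repeat split; auto.
        replace (q (S N) - 0) with (q (S N)) by ring. auto.
      * rewrite E0. field. auto.
    + intros n Hn. rewrite pf_coef_S by lia. field.
      repeat split; auto.
      * apply Cminus_eq_contra, Hq; lia.
      * replace (q n - 0) with (q n) by ring. auto.
      * apply Cminus_eq_contra, Hq; lia.
Qed.

End PartialFractions.

(** * The residues *)

Section Residues.
Open Scope C_scope.

Lemma RtoC_INR_S n : RtoC (INR (S n)) = INR n + 1.
Proof. rewrite S_INR, RtoC_plus. reflexivity. Qed.

Lemma RtoC_INR_plus m n : RtoC (INR (m + n)) = INR m + INR n.
Proof. rewrite plus_INR, RtoC_plus. reflexivity. Qed.

Lemma RtoC_INR_1 : RtoC (INR 1) = 1.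
Proof. reflexivity. Qed.

Lemma RtoC_INR_2 : RtoC (INR 2) = 1 + 1.
Proof. rewrite <- RtoC_plus. reflexivity. Qed.

Lemma pochhammer_S x n : pochhammer x (S n) = pochhammer x n * (x + INR n).
Proof. reflexivity. Qed.

Lemma RtoC_fact_S n : RtoC (INR (fact (S n))) = (INR n + 1) * INR (fact n).
Proof. rewrite fact_simpl, mult_INR, RtoC_mult, RtoC_INR_S. reflexivity. Qed.

Lemma RtoC_fact_neq_0 n : RtoC (INR (fact n)) <> 0.
Proof. apply RtoC_neq_0, not_0_INR, fact_neq_0. Qed.

Lemma INR_plus_1_neq_0 n : INR n + 1 <> 0.
Proof. rewrite <- RtoC_INR_S. apply RtoC_neq_0, not_0_INR. lia. Qed.

Lemma pochhammer_neq_0 x n : (forall k, x + INR k <> 0) -> pochhammer x n <> 0.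
Proof. intros H. rewrite pochhammer_Cprod. apply Cprod_neq_0; auto. Qed.

Lemma pochhammer_shift x n : pochhammer x (S n) = x * pochhammer (1 + x) n.
Proof.
  rewrite !pochhammer_Cprod, Cprod_shift. f_equal; [simpl; ring|].
  apply Cprod_ext. intros k _. rewrite RtoC_INR_S. ring.
Qed.

Lemma pochhammer_add x m n : pochhammer x (m + n) = pochhammer x m * pochhammer (x + INR m) n.
Proof.
  induction n; [rewrite Nat.add_0_r; simpl; ring|].
  rewrite Nat.add_succ_r. simpl. rewrite IHn, RtoC_INR_plus. ring.
Qed.

Lemma Cprod_rev f n : Cprod f n = Cprod (fun k => f (n - 1 - k)%nat) n.
Proof.
  induction n; [reflexivity|].
  rewrite (Cprod_shift (fun k => f (S n - 1 - k)%nat)).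
  change (Cprod f (S n)) with (Cprod f n * f n). rewrite IHn, Cmult_comm. f_equal.
  - f_equal. lia.
  - apply Cprod_ext. intros k Hk. f_equal. lia.
Qed.

Lemma Cprod_reflect x n :
  Cprod (fun k => - x - INR k) n = Cprod (fun _ => - (1)) n * pochhammer x n.
Proof.
  rewrite pochhammer_Cprod, <- Cprod_mult. apply Cprod_ext. intros; ring.
Qed.

(** Read backwards, the factors are -x, -x-1, -x-2, and so on. *)
Lemma Cprod_consecutive x n :
  Cprod (fun k => INR k + 1 - x - INR n) n = Cprod (fun _ => - (1)) n * pochhammer x n.
Proof.
  rewrite <- Cprod_reflect, Cprod_rev. apply Cprod_ext. intros k Hk.
  replace (RtoC (INR n)) with (INR (n - 1 - k) + INR k + 1).
  - ring.
  - rewrite <- RtoC_INR_plus, <- RtoC_INR_S. do 2 f_equal. lia.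
Qed.

Variable z : C.
Hypothesis (Ha : forall k, 2 * z + INR k <> 0).

Definition node_p (k : nat) : C := (1 - z + INR k) ^ 2.
Definition node_q (m : nat) : C := (z + INR m) ^ 2.

(** Squares are chosen as nodes for the sake of this: their differences split into linear factors,
    so the residues become quotients of Pochhammer symbols and factorials. *)
Lemma node_p_minus_q k n :
  node_p k - node_q n = (INR k + 1 - 2 * z - INR n) * (INR k + 1 + INR n).
Proof. unfold node_p, node_q. ring. Qed.

Lemma node_q_minus m n : node_q m - node_q n = (INR m - INR n) * (2 * z + INR n + INR m).
Proof. unfold node_q. ring. Qed.

Lemma node_q_inj m n : m <> n -> node_q m <> node_q n.
Proof.
  intros Hmn E. apply (f_equal (fun x => x - node_q n)) in E.
  rewrite node_q_minus in E. replace (node_q n - node_q n) with (RtoC 0) in E by ring.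
  revert E. apply Cmult_neq_0.
  - rewrite <- RtoC_minus. apply RtoC_neq_0. intros E. apply Rminus_diag_uniq, INR_eq in E. auto.
  - rewrite <- Cplus_assoc, <- RtoC_INR_plus. apply Ha.
Qed.

(* [coef_tail n d] is the part of the residue at [node_q n], for
   [n + d + 1] nodes, which depends on the number of nodes. *)
Definition coef_tail (n d : nat) : C :=
  INR (fact (2 * n + d + 2)) * pochhammer (1 - 2 * z) (d + 2) /
  (INR (fact d) * pochhammer (2 * z) (2 * n + d + 1)).

(** Induction on the number d of nodes after the n-th: each new node multiplies the residue by the
    quotient of consecutive tails. The base case, with n the last node, is a direct evaluation of
    the products. *)
Lemma pf_coef_closed n d :
  pf_coef node_p node_q (n + d) n =
  pochhammer (2 * z) n ^ 2 / INR (fact n) ^ 2 * (2 * (z + INR n)) * coef_tail n d.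
Proof.
  induction d as [|d IH].
  - rewrite Nat.add_0_r. unfold pf_coef.
    rewrite (Cprod_ext (fun k => node_p k - node_q n)
      (fun k => (INR k + 1 - 2 * z - INR n) * (INR k + 1 + INR n)) (S (S n)))
      by (intros; apply node_p_minus_q).
    rewrite Cprod_mult.
    change (Cprod (fun m => if Nat.eq_dec m n then 1 else node_q m - node_q n) (S n))
      with (Cprod (fun m => if Nat.eq_dec m n then 1 else node_q m - node_q n) n *
            (if Nat.eq_dec n n then 1 else node_q n - node_q n)).
    destruct (Nat.eq_dec n n); [|lia].
    rewrite (Cprod_ext (fun m => if Nat.eq_dec m n then 1 else node_q m - node_q n)
      (fun m => (INR m + 1 - 1 - INR n) * (2 * z + INR n + INR m)) n).
    2:{ intros m Hm. destruct (Nat.eq_dec m n); [lia|]. rewrite node_q_minus. ring. }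
    (* [Cprod_consecutive] is used with x = 1 in the denominator and with x = 2z in the numerator,
       so the two signs (-1)^n cancel. *)
    rewrite Cprod_mult, Cprod_consecutive, pochhammer_1.
    rewrite <- (pochhammer_Cprod (2 * z + INR n) n).
    change (Cprod (fun k => INR k + 1 - 2 * z - INR n) (S (S n)))
      with (Cprod (fun k => INR k + 1 - 2 * z - INR n) n * (INR n + 1 - 2 * z - INR n)
            * (INR (S n) + 1 - 2 * z - INR n)).
    rewrite Cprod_consecutive.
    rewrite (Cprod_ext (fun k => INR k + 1 + INR n) (fun k => 1 + INR n + INR k) (S (S n)))
      by (intros; ring).
    rewrite <- (pochhammer_Cprod (1 + INR n) (S (S n))).
    assert (E1 : RtoC (INR (fact (2 * n + 0 + 2))) = INR (fact n) * pochhammer (1 + INR n) (S (S n))).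
    { rewrite <- !pochhammer_1, <- pochhammer_add. f_equal. lia. }
    (* The last factor 2z + 2n of this symbol is what the factor 2(z+n) in the closed form
       compensates. *)
    assert (E2 : pochhammer (2 * z) (2 * n + 0 + 1) =
                 pochhammer (2 * z) n * pochhammer (2 * z + INR n) n * (2 * (z + INR n))).
    { rewrite <- pochhammer_add. replace (2 * n + 0 + 1)%nat with (S (n + n)) by lia.
      simpl pochhammer. rewrite RtoC_INR_plus. ring. }
    unfold coef_tail. rewrite E1, E2, RtoC_INR_S. simpl.
    pose proof (RtoC_fact_neq_0 n).
    pose proof (pochhammer_neq_0 (2 * z) n Ha).
    assert (pochhammer (2 * z + INR n) n <> 0).
    { apply pochhammer_neq_0. intros k. rewrite <- Cplus_assoc, <- RtoC_INR_plus. apply Ha. }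
    assert (Cprod (fun _ => - (1)) n <> 0).
    { apply Cprod_neq_0. intros _ _. rewrite <- RtoC_opp. apply RtoC_neq_0. lra. }
    assert (z + INR n <> 0).
    { intros E. apply (Ha (n + n)%nat). rewrite RtoC_INR_plus.
      replace (2 * z + (INR n + INR n)) with (2 * (z + INR n)) by ring. rewrite E. ring. }
    assert (RtoC (INR 1) = 1) by reflexivity.
    field. repeat split; auto.
  - rewrite Nat.add_succ_r, pf_coef_S by (auto using node_q_inj; lia).
    rewrite IH, node_p_minus_q, node_q_minus. unfold coef_tail.
    replace (2 * n + S d + 2)%nat with (S (2 * n + d + 2)) by lia.
    replace (2 * n + S d + 1)%nat with (S (2 * n + d + 1)) by lia.
    replace (S d + 2)%nat with (S (d + 2)) by lia.
    rewrite !pochhammer_S, !RtoC_fact_S.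
    replace (2 * n)%nat with (n + n)%nat by lia.
    pose proof (Ha (n + n + d + 1)) as H1.
    pose proof (INR_plus_1_neq_0 d) as H2.
    pose proof (RtoC_fact_neq_0 n). pose proof (RtoC_fact_neq_0 d).
    pose proof (pochhammer_neq_0 (2 * z) (n + n + d + 1) Ha).
    repeat first [rewrite RtoC_INR_plus in * | rewrite RtoC_INR_1 in * | rewrite RtoC_INR_2 in *
                 | rewrite RtoC_INR_S in *].
    set (P1 := pochhammer (2 * z) n) in *. set (P2 := pochhammer (2 * z) (n + n + d + 1)) in *.
    set (P3 := pochhammer (1 - 2 * z) (d + 2)) in *.
    field. repeat split; auto.
Qed.

End Residues.

(** * Dominated convergence *)

Lemma Clim_Csum (u : nat -> nat -> C) (l : nat -> C) K :
  (forall k, filterlim (fun N => u N k) eventually (locally (l k))) ->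
  filterlim (fun N => Csum (u N) K) eventually (locally (Csum l K)).
Proof.
  intros H. induction K; simpl; [apply filterlim_const|].
  apply (Clim_plus eventually); auto.
Qed.

(** It suffices that the sums of t_n (rho - 1) tend to 0: a fixed head does so termwise, and the
    rest is at most M + 1 times a tail of the majorant. *)
Lemma tannery (t : nat -> C) (e : nat -> R) (B M : R) (rho : nat -> nat -> C) (T : C) (N0 : nat) :
  (forall k, Cmod (t k) <= e k) -> (forall n, Rsum e n <= B) ->
  (forall N n, (N0 <= N)%nat -> (n <= N)%nat -> Cmod (rho N n) <= M) ->
  (forall n, filterlim (fun N => rho N n) eventually (locally (RtoC 1))) ->
  filterlim (Csum t) eventually (locally T) ->
  filterlim (fun N => Csum (fun n => t n * rho N n)%C (S N)) eventually (locally T).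
Proof.
  intros Ht HB HM Hrho HT.
  assert (He0 : forall k, 0 <= e k).
  { intros k. eapply Rle_trans; [apply Cmod_ge_0|apply Ht]. }
  assert (HM0 : 0 <= M) by (eapply Rle_trans; [apply Cmod_ge_0|apply (HM N0 0%nat); lia]).
  assert (HD : filterlim (fun N => Csum (fun n => t n * (rho N n - 1))%C (S N))
                 eventually (locally (RtoC 0))).
  { apply filterlim_Cmod; [typeclasses eauto|]. intros eps Heps.
    destruct (Rsum_tail e B He0 HB (eps / (2 * (M + 1)))) as [K HK].
    { apply Rdiv_lt_0_compat; lra. }
    assert (Hh : filterlim (fun N => Csum (fun n => t n * (rho N n - 1))%C K)
              eventually (locally (Csum (fun n => t n * (1 - 1))%C K))).
    { apply Clim_Csum. intros k. apply (Clim_mult eventually); [apply filterlim_const|].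
      apply (Clim_minus eventually); [apply Hrho|apply filterlim_const]. }
    assert (Hz : Csum (fun n => t n * (1 - 1))%C K = RtoC 0).
    { clear. induction K; simpl; [reflexivity|]. rewrite IHK. ring. }
    rewrite Hz in Hh.
    destruct (proj1 (filterlim_Cmod eventually _ _) Hh (eps / 2) ltac:(lra)) as [N1 HN1].
    exists (N0 + N1 + K)%nat. intros N HN. specialize (HN1 N ltac:(lia)).
    set (u := fun n => (t n * (rho N n - 1))%C) in *.
    replace (Csum u (S N) - 0)%C with ((Csum u K - 0) + (Csum u (S N) - Csum u K))%C by ring.
    eapply Rle_lt_trans; [apply Cmod_triangle|].
    (* The bound on rho is available only for n <= N, so the terms are cut off there before the tail
       estimate. *)
    set (v := fun n => if Compare_dec.le_dec n N then u n else RtoC 0).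
    assert (Hv : forall m, (m <= S N)%nat -> Csum u m = Csum v m).
    { intros m Hm. apply Csum_ext. intros k Hk. unfold v. destruct (Compare_dec.le_dec k N); [auto|lia]. }
    rewrite (Hv (S N)), (Hv K) at 1 by lia.
    assert (Hvb : forall k, Cmod (v k) <= (M + 1) * e k).
    { intros k. unfold v. destruct (Compare_dec.le_dec k N) as [Hk|Hk].
      - unfold u. rewrite Cmod_mult, Rmult_comm.
        apply Rmult_le_compat; auto using Cmod_ge_0.
        eapply Rle_trans; [apply Cmod_triangle|]. rewrite Cmod_opp, Cmod_1.
        apply Rplus_le_compat_r. apply HM; lia.
      - rewrite Cmod_0. apply Rmult_le_pos; [lra|auto]. }
    pose proof (Csum_tail_le v (fun k => (M + 1) * e k) K (S N) ltac:(lia) Hvb) as Htail.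
    rewrite !Rsum_scal in Htail. specialize (HK (S N)).
    assert ((M + 1) * (Rsum e (S N) - Rsum e K) < eps / 2).
    { replace (eps / 2) with ((M + 1) * (eps / (2 * (M + 1)))) by (field; lra).
      apply Rmult_lt_compat_l; lra. }
    rewrite <- (Hv K) in * by lia. lra. }
  apply filterlim_succ in HT.
  pose proof (Clim_plus eventually _ _ _ _ HT HD) as HS. rewrite Cplus_0_r in HS.
  eapply filterlim_ext; [|exact HS]. intros N. cbv beta. rewrite <- Csum_plus.
  apply Csum_ext. intros n _. ring.
Qed.

(** * The summands *)

Fixpoint lhs_majorant_coef (b : R) (n : nat) : R :=
  match n with O => 1 | S k => lhs_majorant_coef b k * ((b + INR k) / (INR k + 1)) end.

(** Of the same order as the square of (b)_n / n! divided by (n+1)^3; the denominators are arranged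
    so that the sum is controlled by telescoping. *)
Definition lhs_majorant (b : R) (n : nat) : R :=
  (lhs_majorant_coef b n / (INR n + 1)) ^ 2 / (INR n + 2).

Lemma lhs_majorant_coef_ge_0 b n : 0 <= b -> 0 <= lhs_majorant_coef b n.
Proof.
  intros Hb. induction n; simpl; [lra|]. pose proof (pos_INR n).
  apply Rmult_le_pos; auto. apply Rdiv_le_0_compat; lra.
Qed.

Lemma lhs_majorant_ge_0 b n : 0 <= lhs_majorant b n.
Proof.
  unfold lhs_majorant. pose proof (pos_INR n). apply Rdiv_le_0_compat; [apply pow2_ge_0|lra].
Qed.

(* With [x n = (lhs_majorant_coef b n / (n + 1))^2] one has
   [x (n+1) / x n = ((n + b) / (n + 2))^2 <= 1 - (2 - b) / (n + 2)]. *)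
Lemma Rsum_lhs_majorant b n : 0 <= b < 2 -> Rsum (lhs_majorant b) n <= / (2 - b).
Proof.
  intros Hb. set (x := fun n => (lhs_majorant_coef b n / (INR n + 1)) ^ 2).
  assert (H : (2 - b) * Rsum (lhs_majorant b) n <= 1 - x n).
  { induction n.
    - unfold x; simpl. lra.
    - simpl Rsum. rewrite Rmult_plus_distr_l.
      enough ((2 - b) * lhs_majorant b n <= x n - x (S n)) by lra.
      pose proof (pos_INR n) as Hn. set (r := (b + INR n) / (INR n + 2)).
      assert (Hr : 0 <= r <= 1).
      { unfold r. split; [apply Rdiv_le_0_compat; lra|].
        apply Rle_div_l; lra. }
      assert (E : x (S n) = x n * r ^ 2).
      { unfold x, r. simpl lhs_majorant_coef. rewrite S_INR. field. lra. }
      assert (E2 : (2 - b) * lhs_majorant b n = x n * (1 - r)).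
      { unfold lhs_majorant, r. fold (x n). field. lra. }
      rewrite E, E2. assert (x n * r ^ 2 <= x n * r); [|lra].
      apply Rmult_le_compat_l; [apply pow2_ge_0|]. simpl. nra. }
  assert (0 <= x n) by apply pow2_ge_0.
  apply Rmult_le_reg_l with (2 - b); [lra|]. rewrite Rinv_r; lra.
Qed.

Lemma Cmod_pochhammer_le a b n : Cmod a <= b ->
  Cmod (pochhammer a n) <= INR (fact n) * lhs_majorant_coef b n.
Proof.
  intros Ha. induction n; [simpl; rewrite Cmod_1; lra|].
  rewrite pochhammer_S, Cmod_mult. pose proof (pos_INR n) as Hn.
  replace (INR (fact (S n)) * lhs_majorant_coef b (S n))
    with (INR (fact n) * lhs_majorant_coef b n * (b + INR n)).
  - apply Rmult_le_compat; auto using Cmod_ge_0.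
    eapply Rle_trans; [apply Cmod_triangle|]. rewrite Cmod_R, Rabs_right; lra.
  - rewrite fact_simpl, mult_INR, S_INR. simpl. field. lra.
Qed.

Lemma lhs_term_0 (z : C) : z <> 0%C -> lhs_term 0 z = 1%C.
Proof.
  intros Hz. unfold lhs_term. simpl. rewrite Cplus_0_r. field.
  exact Hz.
Qed.

(** One majorant for the whole punctured disc |z| <= r: it serves dominated convergence at a fixed z
    as well as uniform tails near 1/2 and -1/2. The term n = 0 is treated apart, its denominator z^3
    having no lower bound. *)
Lemma lhs_term_le (r : R) (z : C) n : z <> 0%C -> Cmod z <= r -> r < 1 ->
  Cmod (lhs_term n z) <= 27 / (1 - r) ^ 3 * lhs_majorant (2 * r) n.
Proof.
  intros Hz Hr Hr1. pose proof (Cmod_ge_0 z) as Hz0.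
  pose proof (Cmod_gt_0 z) as [Hzp _]. specialize (Hzp Hz).
  assert (Hu : 1 <= / (1 - r) ^ 3).
  { rewrite <- Rinv_1. apply Rinv_le_contravar; [apply pow_lt; lra|].
    rewrite <- (pow1 3). apply pow_incr. lra. }
  destruct n as [|n].
  - rewrite lhs_term_0, Cmod_1 by exact Hz.
    replace (lhs_majorant (2 * r) 0) with (1 / 2) by (unfold lhs_majorant; simpl; field).
    unfold Rdiv. lra.
  - unfold lhs_term. set (m := S n).
    assert (Hm : 1 <= INR m) by (change 1 with (INR 1); apply le_INR; unfold m; lia).
    pose proof (Cmod_pochhammer_le (2 * z) (2 * r) m) as HP.
    rewrite Cmod_mult, Cmod_R, Rabs_right in HP by lra. specialize (HP ltac:(lra)).
    set (f := INR (fact m)) in *. set (g := lhs_majorant_coef (2 * r) m) in *.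
    assert (Hf : 0 < f) by apply INR_fact_lt_0.
    assert (Hg : 0 <= g) by (apply lhs_majorant_coef_ge_0; lra).
    (* From |z+m| >= m - r, as m - r >= (1-r)(m+2)/3 for m >= 1; cubing gives the constant
       27/(1-r)^3. *)
    assert (Hzm : (1 - r) * (INR m + 2) / 3 <= Cmod (z + INR m)%C).
    { pose proof (Cmod_triangle_minus (INR m) (- z)%C) as H.
      replace (- z - INR m)%C with (- (z + INR m))%C in H by ring.
      rewrite !Cmod_opp, Cmod_R, Rabs_right in H by lra. nra. }
    assert (Hc : 0 < (1 - r) * (INR m + 2) / 3) by nra.
    set (c := (1 - r) * (INR m + 2) / 3) in *.
    assert (Nzm : (z + INR m)%C <> 0%C) by (apply Cmod_gt_0; lra).
    rewrite Cmod_div.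
    2:{ apply Cmult_neq_0; apply Cpow_nz; auto. apply RtoC_neq_0. lra. }
    rewrite !Cmod_mult, !Cmod_pow, Cmod_R, (Rabs_right f) by lra.
    apply Rle_trans with ((f * g) ^ 2 * 1 / (f ^ 2 * c ^ 3)).
    + unfold Rdiv. apply Rmult_le_compat.
      * apply Rmult_le_pos; apply pow_le; apply Cmod_ge_0.
      * left. apply Rinv_0_lt_compat. apply Rmult_lt_0_compat; apply pow_lt; lra.
      * apply Rmult_le_compat; try (apply pow_le, Cmod_ge_0).
        -- apply pow_incr. split; auto using Cmod_ge_0.
        -- rewrite <- (pow1 3). apply pow_incr. lra.
      * apply Rinv_le_contravar.
        -- apply Rmult_lt_0_compat; apply pow_lt; lra.
        -- apply Rmult_le_compat_l; [apply pow2_ge_0|]. apply pow_incr. lra.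
    + replace ((f * g) ^ 2 * 1 / (f ^ 2 * c ^ 3))
        with (27 / (1 - r) ^ 3 * (g ^ 2 / (INR m + 2) ^ 3)) by (unfold c; field; lra).
      apply Rmult_le_compat_l; [unfold Rdiv; lra|]. unfold lhs_majorant. fold g.
      replace (g ^ 2 / (INR m + 2) ^ 3) with (g ^ 2 / (INR m + 2) * / (INR m + 2) ^ 2)
        by (field; lra).
      replace ((g / (INR m + 1)) ^ 2 / (INR m + 2)) with (g ^ 2 / (INR m + 2) * / (INR m + 1) ^ 2)
        by (field; lra).
      apply Rmult_le_compat_l.
      * apply Rdiv_le_0_compat; [apply pow2_ge_0|lra].
      * apply Rinv_le_contravar; [apply pow_lt; lra|]. apply pow_incr. lra.
Qed.

Lemma Rsum_lhs_majorant_scal c b n : 0 <= b < 2 -> 0 <= c ->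
  Rsum (fun k => c * lhs_majorant b k) n <= c * / (2 - b).
Proof. intros Hb Hc. rewrite Rsum_scal. apply Rmult_le_compat_l; auto. apply Rsum_lhs_majorant, Hb. Qed.

(** * Passage to the limit *)

Lemma Cmod_INR_plus_ge N (v : C) : INR N - Cmod v <= Cmod (INR N + v)%C.
Proof.
  pose proof (Cmod_triangle_minus (INR N) (- v)%C) as H.
  replace (- v - INR N)%C with (- (INR N + v))%C in H by ring.
  rewrite !Cmod_opp, Cmod_R, Rabs_right in H by (apply Rle_ge, pos_INR). lra.
Qed.

Lemma Clim_INR_ratio (u v : C) :
  filterlim (fun N => (INR N + u) / (INR N + v))%C eventually (locally (RtoC 1)).
Proof.
  apply filterlim_Cmod; [typeclasses eauto|]. intros eps He.
  pose proof (Cmod_ge_0 v). pose proof (Cmod_ge_0 (u - v)%C).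
  destruct (INR_unbounded (Cmod v + Cmod (u - v)%C / eps + 1)) as [N0 HN0].
  exists N0. intros N HN. apply le_INR in HN.
  pose proof (Cmod_INR_plus_ge N v) as HG.
  assert (0 <= Cmod (u - v)%C / eps) by (apply Rdiv_le_0_compat; lra).
  assert (Hnz : (INR N + v)%C <> 0%C) by (apply Cmod_gt_0; lra).
  replace ((INR N + u) / (INR N + v) - 1)%C with ((u - v) / (INR N + v))%C by (field; auto).
  rewrite Cmod_div by auto. apply Rlt_div_l; [lra|].
  apply Rle_lt_trans with (eps * (Cmod (u - v)%C / eps)); [right; field; lra|].
  apply Rmult_lt_compat_l; lra.
Qed.

Section Terms.
Variable z : C.
Hypothesis (Hz1 : Cmod z < 1) (Hz0 : z <> 0%C).
Hypothesis (Ha : forall k, (2 * z + INR k)%C <> 0%C).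
Hypothesis (Hb : forall k, (1 - 2 * z + INR k)%C <> 0%C).

Lemma coef_tail_neq_0 n d : coef_tail z n d <> 0%C.
Proof.
  unfold coef_tail. apply Cmult_neq_0.
  - apply Cmult_neq_0; [apply RtoC_fact_neq_0 | apply pochhammer_neq_0; auto].
  - intros E. apply C1_nz.
    rewrite <- (Cinv_r (INR (fact d) * pochhammer (2 * z) (2 * n + d + 1))%C).
    + rewrite E. ring.
    + apply Cmult_neq_0; [apply RtoC_fact_neq_0 | apply pochhammer_neq_0; auto].
Qed.

(** The pairs (n+1, d) and (n, d+1) belong to the same number of nodes, so this compares
    neighbouring residues of one expansion. *)
Lemma coef_tail_S n d :
  (coef_tail z (S n) d = coef_tail z n (S d) *
     ((2 * INR n + INR d + 4) / (2 * z + (2 * INR n + INR d + 2)) *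
      ((INR d + 1) / (INR d + 1 + (2 - 2 * z)))))%C.
Proof.
  unfold coef_tail.
  replace (2 * S n + d + 2)%nat with (S (n + n + d + 3)) by lia.
  replace (2 * n + S d + 2)%nat with (n + n + d + 3)%nat by lia.
  replace (2 * S n + d + 1)%nat with (S (n + n + d + 2)) by lia.
  replace (2 * n + S d + 1)%nat with (n + n + d + 2)%nat by lia.
  replace (S d + 2)%nat with (S (d + 2)) by lia.
  rewrite !pochhammer_S, !RtoC_fact_S.
  pose proof (Ha (n + n + d + 2)) as H1. pose proof (Hb (d + 2)) as H2.
  pose proof (INR_plus_1_neq_0 d) as H3.
  pose proof (RtoC_fact_neq_0 d).
  pose proof (pochhammer_neq_0 (2 * z) (n + n + d + 2) Ha).
  pose proof (pochhammer_neq_0 (1 - 2 * z) (d + 2) Hb).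
  replace (INR 3) with (2 + 1) in * by (simpl; ring).
  repeat first [rewrite RtoC_INR_plus in * | rewrite RtoC_INR_1 in * | rewrite RtoC_INR_2 in *
               | rewrite RtoC_INR_S in *].
  field. repeat split; auto.
  - intros E. apply H2. rewrite <- E. ring.
  - intros E. apply H1. rewrite <- E. ring.
Qed.

Definition coef_ratio (N n : nat) : C := (coef_tail z n (N - n) / coef_tail z 0 N)%C.

Lemma coef_ratio_0 N : coef_ratio N 0 = 1%C.
Proof. unfold coef_ratio. rewrite Nat.sub_0_r. field. apply coef_tail_neq_0. Qed.

Lemma coef_ratio_S N n : (n < N)%nat ->
  coef_ratio N (S n) = (coef_ratio N n *
    ((INR N + (INR n + 3)) / (INR N + (INR n + 1 + 2 * z)) *
     ((INR N + - INR n) / (INR N + (2 - 2 * z - INR n)))))%C.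
Proof.
  intros Hn. unfold coef_ratio. rewrite coef_tail_S.
  replace (S (N - S n)) with (N - n)%nat by lia.
  assert (E : RtoC (INR (N - S n)) = (INR N - INR n - 1)%C).
  { replace (RtoC (INR N)) with (RtoC (INR (N - S n + S n))) by (do 2 f_equal; lia).
    rewrite RtoC_INR_plus, RtoC_INR_S. ring. }
  rewrite E. unfold Cdiv.
  replace (2 * INR n + (INR N - INR n - 1) + 4)%C with (INR N + (INR n + 3))%C by ring.
  replace (2 * z + (2 * INR n + (INR N - INR n - 1) + 2))%C
    with (INR N + (INR n + 1 + 2 * z))%C by ring.
  replace (INR N - INR n - 1 + 1)%C with (INR N + - INR n)%C by ring.
  replace (INR N + - INR n + (2 - 2 * z))%C with (INR N + (2 - 2 * z - INR n))%C by ring.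
  ring.
Qed.

Lemma Clim_coef_ratio n : filterlim (fun N => coef_ratio N n) eventually (locally (RtoC 1)).
Proof.
  induction n.
  - eapply filterlim_ext; [intros N; symmetry; apply coef_ratio_0|]. apply filterlim_const.
  - eapply filterlim_ext_loc.
    + exists (S n). intros N HN. symmetry. apply coef_ratio_S. lia.
    + rewrite <- (Cmult_1_l 1). apply (Clim_mult eventually); [exact IHn|].
      rewrite <- (Cmult_1_l 1). apply (Clim_mult eventually); apply Clim_INR_ratio.
Qed.

Lemma Cmod_two_z : Cmod (2 * z)%C <= 2.
Proof. rewrite Cmod_mult, Cmod_R, Rabs_right; lra. Qed.

(** The ratio is a product of n steps, each at most 1 + 4/(N-1). Together they stay below
    exp(4N/(N-1)), and 4N/(N-1) <= 8 for N >= 2. *)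
Lemma Cmod_coef_ratio_le N n : (2 <= N)%nat -> (n <= N)%nat ->
  Cmod (coef_ratio N n) <= exp 8.
Proof.
  intros HN Hn. apply le_INR in HN as HN'. simpl in HN'.
  pose proof Cmod_two_z as H2z.
  set (c := 4 / (INR N - 1)). assert (Hc : 0 < c) by (apply Rdiv_lt_0_compat; lra).
  assert (H : Cmod (coef_ratio N n) <= exp (INR n * c)).
  { induction n.
    - rewrite coef_ratio_0, Cmod_1. simpl. rewrite Rmult_0_l, exp_0. lra.
    - rewrite coef_ratio_S by lia. rewrite S_INR.
      replace ((INR n + 1) * c) with (INR n * c + c) by ring.
      rewrite exp_plus, Cmod_mult. specialize (IHn ltac:(lia)).
      assert (HnN : INR n + 1 <= INR N) by (rewrite <- S_INR; apply le_INR; lia).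
      pose proof (pos_INR n) as Hn0.
      apply Rmult_le_compat; auto using Cmod_ge_0.
      (* With |2z| <= 2 the numerator N+n+3 exceeds this lower bound by at most 4, which is the 4 in
         [c]. *)
      assert (D1 : INR N + INR n - 1 <= Cmod (INR N + (INR n + 1 + 2 * z))%C).
      { pose proof (Cmod_INR_plus_ge (N + n + 1) (2 * z)%C) as H.
        rewrite !plus_INR in H. simpl (INR 1) in H.
        replace (INR N + (INR n + 1 + 2 * z))%C with (RtoC (INR N + INR n + 1) + 2 * z)%C
          by (rewrite !RtoC_plus; ring). lra. }
      (* The summand 2, present because the zeros reach up to k = N+2, offsets |2z| <= 2; hence the
         second quotient never exceeds 1. *)
      assert (D2 : INR N - INR n <= Cmod (INR N + (2 - 2 * z - INR n))%C).
      { pose proof (Cmod_INR_plus_ge (N - n + 2) (- (2 * z))%C) as H.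
        rewrite Cmod_opp, plus_INR, minus_INR in H by lia. simpl (INR 2) in H.
        replace (INR N + (2 - 2 * z - INR n))%C
          with (RtoC (INR N - INR n + (1 + 1)) + - (2 * z))%C
          by (rewrite !RtoC_plus, RtoC_minus; ring). lra. }
      rewrite Cmod_mult, !Cmod_div by (apply Cmod_gt_0; lra).
      replace (INR N + (INR n + 3))%C with (RtoC (INR N + INR n + 3))
        by (rewrite !RtoC_plus; ring).
      replace (INR N + - INR n)%C with (RtoC (INR N - INR n)) by (rewrite RtoC_minus; ring).
      rewrite !Cmod_R, !Rabs_right by lra.
      assert (F1 : (INR N + INR n + 3) / Cmod (INR N + (INR n + 1 + 2 * z))%C <= exp c).
      { apply Rle_trans with (1 + c); [|apply exp_ineq1_le].
        apply Rle_div_l; [lra|].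
        apply Rle_trans with ((1 + c) * (INR N + INR n - 1)).
        - assert (Ec : c * (INR N - 1) = 4) by (unfold c; field; lra). nra.
        - apply Rmult_le_compat_l; lra. }
      assert (F2 : (INR N - INR n) / Cmod (INR N + (2 - 2 * z - INR n))%C <= 1).
      { apply Rle_div_l; lra. }
      rewrite <- (Rmult_1_r (exp c)). apply Rmult_le_compat; auto.
      + apply Rdiv_le_0_compat; lra.
      + apply Rdiv_le_0_compat; lra. }
  eapply Rle_trans; [exact H|]. apply exp_le_compat.
  apply le_INR in Hn. apply Rle_trans with (INR N * c).
  - apply Rmult_le_compat_r; lra.
  - assert (Ec : c * (INR N - 1) = 4) by (unfold c; field; lra). nra.
Qed.

Lemma z_plus_INR_neq_0 k : (z + INR k)%C <> 0%C.
Proof.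
  intros E. apply (Ha (k + k)). rewrite RtoC_INR_plus.
  replace (2 * z + (INR k + INR k))%C with (2 * (z + INR k))%C by ring. rewrite E. ring.
Qed.

Lemma one_minus_z_neq_0 k : (1 - z + INR k)%C <> 0%C.
Proof.
  apply Cmod_gt_0. pose proof (Cmod_INR_plus_ge (k + 1) (- z)%C) as H.
  rewrite Cmod_opp, plus_INR in H. simpl (INR 1) in H. pose proof (pos_INR k).
  replace (1 - z + INR k)%C with (RtoC (INR k + 1) + - z)%C by (rewrite RtoC_plus; ring). lra.
Qed.

Lemma one_plus_neq_0 (w : C) k : (forall m, (w + INR m)%C <> 0%C) -> (1 + w + INR k)%C <> 0%C.
Proof.
  intros H E. apply (H (S k)). rewrite RtoC_INR_S, <- E. ring.
Qed.

Definition scale (N : nat) : C := (z ^ 3 / (2 * coef_tail z 0 N))%C.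

(** Dividing the residue by [node_q z n ^ 2] turns 2(z+n) into 2/(z+n)^3, and [scale] is normalised
    to leave exactly [lhs_term]. The isolated [scale N] compensates the -1 contributed by the
    polynomial part. *)
Lemma truncated_sum N :
  Csum (fun n => lhs_term n z * coef_ratio N n)%C (S N) =
  (scale N + scale N * pf_ratio (node_p z) (node_q z) N 0 *
   (Csum (fun m => / node_q z m) (S N) - Csum (fun k => / node_p z k) (S (S N))))%C.
Proof.
  rewrite <- (Cmult_assoc (scale N)), partial_fractions_deriv.
  - replace (scale N + scale N * (- (1) + Csum
       (fun n => pf_coef (node_p z) (node_q z) N n / node_q z n ^ 2) (S N)))%C
      with (scale N * Csum
       (fun n => pf_coef (node_p z) (node_q z) N n / node_q z n ^ 2) (S N))%C by ring.
    rewrite <- Csum_scal. apply Csum_ext. intros n Hn.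
    replace (pf_coef (node_p z) (node_q z) N n)
      with (pf_coef (node_p z) (node_q z) (n + (N - n)) n) by (f_equal; lia).
    rewrite pf_coef_closed by exact Ha.
    unfold scale, coef_ratio, lhs_term, node_q. field.
    repeat split; auto using coef_tail_neq_0, RtoC_fact_neq_0, z_plus_INR_neq_0.
  - apply node_q_inj, Ha.
  - intros k. apply Cpow_nz, one_minus_z_neq_0.
  - intros m. apply Cpow_nz, z_plus_INR_neq_0.
Qed.

End Terms.

(** * The finite formula in terms of Gauss products, and its limit *)

Lemma pochhammer_Gamma_seq (w : C) n : (forall k, (w + INR k)%C <> 0%C) ->
  pochhammer w (S n) = (INR (fact n) * Cexp (w * ln (INR n)) / Gamma_seq w n)%C.
Proof.
  intros Hw. unfold Gamma_seq. field.
  repeat split; auto using RtoC_fact_neq_0, Cexp_neq_0, pochhammer_neq_0.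
Qed.

(** Moves from w to 1 + w, because the right-hand side of the theorem contains Gamma at 1+z and
    1+2z. *)
Lemma pochhammer_shift_div (w : C) n : (forall k, (w + INR k)%C <> 0%C) ->
  pochhammer w n = (w * pochhammer (1 + w) (S n) / ((INR n + w) * (INR n + (w + 1))))%C.
Proof.
  intros Hw. rewrite <- pochhammer_shift, !pochhammer_S, RtoC_INR_S.
  pose proof (Hw n) as H1. pose proof (Hw (S n)) as H2. rewrite RtoC_INR_S in H2.
  field. split; intros E; [apply H2 | apply H1]; rewrite <- E; ring.
Qed.

Lemma Cexp_neg_ln_lim (w : C) : Re w < 0 ->
  filterlim (fun N => Cexp (w * ln (INR (S N)))%C) eventually (locally (RtoC 0)).
Proof.
  intros Hw. apply filterlim_Cmod; [typeclasses eauto|]. intros eps He.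
  destruct (INR_unbounded (exp (ln eps / Re w))) as [N0 HN0].
  exists N0. intros N HN.
  replace (Cexp (w * ln (INR (S N))) - 0)%C with (Cexp (w * ln (INR (S N)))) by ring.
  rewrite Cmod_Cexp, re_scal_r, <- (exp_ln eps He). apply exp_increasing.
  assert (H : ln eps / Re w < ln (INR (S N))).
  { rewrite <- (ln_exp (ln eps / Re w)). apply ln_increasing; [apply exp_pos|].
    eapply Rlt_le_trans; [exact HN0|]. apply le_INR. lia. }
  replace (ln eps) with (Re w * (ln eps / Re w)) by (field; lra).
  apply Rmult_lt_gt_compat_neg_l; auto.
Qed.

Section Limit.
Variable z : C.
Hypothesis (Hz1 : Cmod z < 1) (Hz0 : z <> 0%C).
Hypothesis (Ha : forall k, (2 * z + INR k)%C <> 0%C).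
Hypothesis (Hb : forall k, (1 - 2 * z + INR k)%C <> 0%C).

Let Hz k : (z + INR k)%C <> 0%C.
Proof. apply z_plus_INR_neq_0, Ha. Qed.
Let H1z k : (1 + z + INR k)%C <> 0%C.
Proof. apply one_plus_neq_0, Hz. Qed.
Let H1a k : (1 + 2 * z + INR k)%C <> 0%C.
Proof. apply one_plus_neq_0, Ha. Qed.
Let H1mz k : (1 - z + INR k)%C <> 0%C.
Proof. apply one_minus_z_neq_0, Hz1. Qed.

Let shift_neq (w : C) N : (forall k, (w + INR k)%C <> 0%C) -> (INR (S N) + w)%C <> 0%C.
Proof. intros H. rewrite Cplus_comm. apply H. Qed.

Let shift_neq' (w : C) N : (forall k, (w + INR k)%C <> 0%C) -> (INR (S N) + (w + 1))%C <> 0%C.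
Proof. intros H E. apply (H (S (S N))). rewrite (RtoC_INR_S (S N)), <- E. ring. Qed.

Let INR_S_neq N : RtoC (INR (S N)) <> 0%C.
Proof. apply RtoC_neq_0, not_0_INR. lia. Qed.

Let INR_S_neq' N : (RtoC (INR (S N)) + 1)%C <> 0%C.
Proof. apply INR_plus_1_neq_0. Qed.

(** An exact identity, so no Stirling-type estimate is needed: the Gauss products have known limits
    and the rest is of order n^(4-4z). The index n = N+1 is the length of the Pochhammer symbol in
    the denominator. *)
Lemma coef_tail_0_asymp N :
  let n := S N in
  coef_tail z 0 N =
  (INR n * (INR n + 1) * (INR n + 2 * z) * (INR n + (2 * z + 1)) / (2 * z)
   * (Gamma_seq (1 + 2 * z) n / Gamma_seq (1 - 2 * z) n) / Cexp (z * ln (INR n)) ^ 4)%C.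
Proof.
  intros n. unfold coef_tail.
  replace (2 * 0 + N + 2)%nat with (S n) by (unfold n; lia).
  replace (2 * 0 + N + 1)%nat with n by (unfold n; lia).
  replace (N + 2)%nat with (S n) by (unfold n; lia).
  rewrite (pochhammer_shift_div (2 * z)) by exact Ha.
  rewrite (pochhammer_Gamma_seq (1 - 2 * z)), (pochhammer_Gamma_seq (1 + 2 * z)) by auto.
  assert (E : RtoC (INR (fact (S n))) = ((INR n + 1) * (INR n * INR (fact N)))%C).
  { rewrite RtoC_fact_S. unfold n at 2. rewrite RtoC_fact_S. unfold n. rewrite RtoC_INR_S. ring. }
  rewrite E.
  assert (Hn : 0 < INR n) by (apply lt_0_INR; unfold n; lia).
  assert (E1 : Cexp ((1 - 2 * z) * ln (INR n)) = (INR n / Cexp (z * ln (INR n)) ^ 2)%C).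
  { replace ((1 - 2 * z) * ln (INR n))%C
      with (ln (INR n) + (- (z * ln (INR n)) + - (z * ln (INR n))))%C by ring.
    rewrite !Cexp_plus, Cexp_opp, Cexp_ln by exact Hn. field. apply Cexp_neq_0. }
  assert (E2 : Cexp ((1 + 2 * z) * ln (INR n)) = (INR n * Cexp (z * ln (INR n)) ^ 2)%C).
  { replace ((1 + 2 * z) * ln (INR n))%C
      with (ln (INR n) + (z * ln (INR n) + z * ln (INR n)))%C by ring.
    rewrite !Cexp_plus, Cexp_ln by exact Hn. ring. }
  rewrite E1, E2.
  pose proof (Ha 0) as Ha0. simpl in Ha0. rewrite Cplus_0_r in Ha0.
  field.
  repeat split; auto using Cexp_neq_0, RtoC_fact_neq_0, Gamma_seq_neq_0; unfold n; auto.
Qed.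

Lemma scale_asymp N :
  let n := S N in
  scale z N = (z ^ 4 * (Gamma_seq (1 - 2 * z) n / Gamma_seq (1 + 2 * z) n)
    * Cexp ((4 * z - 4) * ln (INR n))
    * ((INR n + 0) / (INR n + 1) * ((INR n + 0) / (INR n + 2 * z))
       * ((INR n + 0) / (INR n + (2 * z + 1)))))%C.
Proof.
  intros n. unfold scale. rewrite coef_tail_0_asymp. fold n.
  assert (Hn : 0 < INR n) by (apply lt_0_INR; unfold n; lia).
  assert (E : Cexp ((4 * z - 4) * ln (INR n)) = (Cexp (z * ln (INR n)) ^ 4 / INR n ^ 4)%C).
  { set (u := (z * ln (INR n))%C). set (v := RtoC (ln (INR n))).
    replace ((4 * z - 4) * v)%C with (u + u + u + u + (- v + - v + - v + - v))%C
      by (unfold u, v; ring).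
    rewrite !Cexp_plus, !Cexp_opp. unfold v. rewrite Cexp_ln by exact Hn. field.
    apply RtoC_neq_0. lra. }
  rewrite E. rewrite !Cplus_0_r. field.
  repeat split; auto using Cexp_neq_0, Gamma_seq_neq_0; unfold n; auto.
Qed.

(** At y = 0 the ratio is the square of (1-z)_{n+1}/(z)_n, of order n^(4-4z). This cancels the power
    n^(4z-4) in [scale], so only Gamma quotients and factors tending to 1 are left. *)
Lemma scale_pf_ratio_asymp N :
  let n := S N in
  (scale z N * pf_ratio (node_p z) (node_q z) N 0)%C =
  (z ^ 2 * (Gamma_seq (1 + z) n ^ 2 * Gamma_seq (1 - 2 * z) n /
            (Gamma_seq (1 - z) n ^ 2 * Gamma_seq (1 + 2 * z) n))
    * ((INR n + z) / (INR n + 0) * ((INR n + z) / (INR n + 1))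
       * ((INR n + (z + 1)) / (INR n + 2 * z))
       * ((INR n + (z + 1)) / (INR n + (2 * z + 1)))))%C.
Proof.
  intros n. unfold scale. rewrite coef_tail_0_asymp. fold n.
  assert (Hn : 0 < INR n) by (apply lt_0_INR; unfold n; lia).
  assert (E : pf_ratio (node_p z) (node_q z) N 0 =
              ((pochhammer (1 - z) (S n) / pochhammer z n) ^ 2)%C).
  { unfold pf_ratio. rewrite !pochhammer_Cprod. fold n.
    rewrite (Cprod_ext (fun k => node_p z k - 0)%C
               (fun k => (1 - z + INR k) * (1 - z + INR k))%C)
      by (intros; unfold node_p; ring).
    rewrite (Cprod_ext (fun k => node_q z k - 0)%C (fun k => (z + INR k) * (z + INR k))%C)
      by (intros; unfold node_q; ring).
    rewrite !Cprod_mult. field. apply Cprod_neq_0; auto. }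
  rewrite E, (pochhammer_shift_div z) by exact Hz.
  rewrite (pochhammer_Gamma_seq (1 - z)), (pochhammer_Gamma_seq (1 + z)) by auto.
  assert (E1 : Cexp ((1 - z) * ln (INR n)) = (INR n / Cexp (z * ln (INR n)))%C).
  { replace ((1 - z) * ln (INR n))%C with (ln (INR n) + - (z * ln (INR n)))%C by ring.
    rewrite !Cexp_plus, Cexp_opp, Cexp_ln by exact Hn. reflexivity. }
  assert (E2 : Cexp ((1 + z) * ln (INR n)) = (INR n * Cexp (z * ln (INR n)))%C).
  { replace ((1 + z) * ln (INR n))%C with (ln (INR n) + z * ln (INR n))%C by ring.
    rewrite !Cexp_plus, Cexp_ln by exact Hn. reflexivity. }
  rewrite E1, E2. rewrite !Cplus_0_r. field.
  repeat split; auto using Cexp_neq_0, RtoC_fact_neq_0, Gamma_seq_neq_0; unfold n; auto.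
Qed.

Let Clim_shift_ratio u v :
  filterlim (fun N => (INR (S N) + u) / (INR (S N) + v))%C eventually (locally (RtoC 1)).
Proof. apply (filterlim_succ _ _ (Clim_INR_ratio u v)). Qed.

(** The power n^(4z-4) decays because Re z <= |z| < 1; this is how the polynomial part
    disappears. *)
Lemma Clim_scale : filterlim (scale z) eventually (locally (RtoC 0)).
Proof.
  destruct (Gamma_cv _ H1a) as [G3 G3n]. destruct (Gamma_cv _ Hb) as [G4 _].
  eapply filterlim_ext; [intros N; symmetry; apply scale_asymp|]. cbv beta zeta.
  replace (RtoC 0) with
    (z ^ 4 * (Gamma (1 - 2 * z) / Gamma (1 + 2 * z)) * 0 * (1 * 1 * 1))%C by ring.
  apply (Clim_mult eventually); [apply (Clim_mult eventually); [apply (Clim_mult eventually)|]|].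
  - apply filterlim_const.
  - apply (Clim_div eventually); auto; apply filterlim_succ; auto.
  - apply Cexp_neg_ln_lim. destruct z as [x y]. simpl.
    pose proof (re_le_Cmod (x, y)) as H. simpl in H. pose proof (Rle_abs x). lra.
  - apply (Clim_mult eventually); [apply (Clim_mult eventually)|]; apply Clim_shift_ratio.
Qed.

Lemma Clim_scale_pf_ratio :
  filterlim (fun N => scale z N * pf_ratio (node_p z) (node_q z) N 0)%C eventually
    (locally (z ^ 2 * (Gamma (1 + z) ^ 2 * Gamma (1 - 2 * z) /
                       (Gamma (1 - z) ^ 2 * Gamma (1 + 2 * z))))%C).
Proof.
  destruct (Gamma_cv _ H1z) as [G1 _]. destruct (Gamma_cv _ H1mz) as [G2 G2n].
  destruct (Gamma_cv _ H1a) as [G3 G3n]. destruct (Gamma_cv _ Hb) as [G4 _].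
  eapply filterlim_ext; [intros N; symmetry; apply scale_pf_ratio_asymp|]. cbv beta zeta.
  match goal with |- filterlim _ _ (locally ?l) =>
    replace l with (l * (1 * 1 * 1 * 1))%C by ring end.
  apply (Clim_mult eventually); [apply (Clim_mult eventually)|].
  - apply filterlim_const.
  - apply (Clim_div eventually); [apply Cmult_neq_0; [apply Cpow_nz|]; auto| |];
      (apply (Clim_mult eventually); [apply (Clim_pow eventually)|]; apply filterlim_succ; auto).
  - apply (Clim_mult eventually); [apply (Clim_mult eventually);
      [apply (Clim_mult eventually)|]|]; apply Clim_shift_ratio.
Qed.

(** The node m = 0 is split off because the target has [polygamma 1] at 1+z; its 1/z^2, times the
    factor z^2 of [Clim_scale_pf_ratio], is the leading 1 in [rhs]. *)
Lemma Clim_nodes :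
  filterlim (fun N => Csum (fun m => / node_q z m) (S N) - Csum (fun k => / node_p z k) (S (S N)))%C
    eventually (locally (/ z ^ 2 + polygamma 1 (1 + z) - polygamma 1 (1 - z))%C).
Proof.
  apply (Clim_minus eventually).
  - eapply filterlim_ext; [intros N; symmetry; apply Csum_shift|]. cbv beta.
    apply (Clim_plus eventually).
    + replace (/ z ^ 2)%C with (/ node_q z 0)%C.
      * apply filterlim_const.
      * unfold node_q. simpl (INR 0). now rewrite Cplus_0_r.
    + eapply filterlim_ext; [|apply (polygamma_1_cv (1 + z) H1z)].
      intros N. apply Csum_ext. intros k _. unfold node_q. rewrite RtoC_INR_S. do 2 f_equal. ring.
  - apply (filterlim_succ (fun N => Csum (fun k => / node_p z k)%C (S N))), filterlim_succ.
    apply (polygamma_1_cv (1 - z) H1mz).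
Qed.

Lemma lhs_series_cv : filterlim (Csum (fun n => lhs_term n z)) eventually (locally (rhs z)).
Proof.
  set (r := Cmod z).
  assert (Hr : 0 <= r) by apply Cmod_ge_0.
  assert (Ht : forall n, Cmod (lhs_term n z) <= 27 / (1 - r) ^ 3 * lhs_majorant (2 * r) n).
  { intros n. apply lhs_term_le; auto. apply Rle_refl. }
  assert (HB : forall n, Rsum (fun k => 27 / (1 - r) ^ 3 * lhs_majorant (2 * r) k) n
                 <= 27 / (1 - r) ^ 3 * / (2 - 2 * r)).
  { intros n. fold r in Hz1. apply Rsum_lhs_majorant_scal; [lra|].
    apply Rdiv_le_0_compat; [lra|]. apply pow_lt. lra. }
  destruct (Csum_abs_cv _ _ _ Ht HB) as [T HT].
  replace (rhs z) with T; [exact HT|].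
  (* The truncated sums have two limits to be identified: the sum T of the series by [tannery], and
     [rhs z] by the closed form. *)
  apply (Clim_unique eventually
           (fun N => Csum (fun n => lhs_term n z * coef_ratio z N n)%C (S N))).
  - apply (tannery _ _ _ (exp 8) _ _ 2 Ht HB); auto.
    + intros N n HN Hn. apply Cmod_coef_ratio_le; auto.
    + intros n. apply Clim_coef_ratio; auto.
  - eapply filterlim_ext; [intros N; symmetry; apply truncated_sum; auto|]. cbv beta.
    replace (rhs z) with (0 + (z ^ 2 * (Gamma (1 + z) ^ 2 * Gamma (1 - 2 * z) /
                       (Gamma (1 - z) ^ 2 * Gamma (1 + 2 * z)))) *
        (/ z ^ 2 + polygamma 1 (1 + z) - polygamma 1 (1 - z)))%C.
    + apply (Clim_plus eventually); [apply Clim_scale|].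
      apply (Clim_mult eventually); [apply Clim_scale_pf_ratio|apply Clim_nodes].
    + unfold rhs. destruct (Gamma_cv _ H1a) as [_ G3n]. destruct (Gamma_cv _ H1mz) as [_ G2n].
      field. auto.
Qed.

End Limit.

(** * The exceptional points *)

(** The nonvanishing hypotheses fail only if 2z is an integer, and |2z| < 2 leaves just 0, 1 and
    -1. *)
Lemma lhs_series_cv_generic (z : C) :
  Cmod z < 1 -> z <> 0%C -> z <> (1 / 2)%C -> z <> (- (1 / 2))%C ->
  filterlim (Csum (fun n => lhs_term n z)) eventually (locally (rhs z)).
Proof.
  intros Hz H0 Hp Hm.
  assert (H2 : RtoC 2 <> 0%C) by (apply RtoC_neq_0; lra).
  assert (Hbig : forall k, Cmod (2 * z)%C <> INR (k + 2)).
  { intros k. rewrite Cmod_mult, Cmod_R, Rabs_right by lra.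
    rewrite plus_INR. simpl (INR 2). pose proof (pos_INR k). lra. }
  apply lhs_series_cv; auto; intros k E.
  - destruct k as [|[|k]].
    + apply H0. simpl in E. replace z with ((2 * z + 0) / 2)%C by (field; auto).
      rewrite E. field. auto.
    + apply Hm. change (RtoC (INR 1)) with (RtoC 1) in E.
      replace z with ((2 * z + 1) / 2 - 1 / 2)%C by (field; auto). rewrite E. field. auto.
    + apply (Hbig k). replace (2 * z)%C with (2 * z + INR (S (S k)) - INR (S (S k)))%C by ring.
      rewrite E. replace (0 - INR (S (S k)))%C with (- INR (S (S k)))%C by ring.
      rewrite Cmod_opp, Cmod_R, Rabs_right by (apply Rle_ge, pos_INR). f_equal. lia.
  - destruct k as [|k].
    + apply Hp. simpl in E. replace z with ((1 - (1 - 2 * z + 0)) / 2)%C by (field; auto).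
      rewrite E. field. auto.
    + apply (Hbig k). rewrite RtoC_INR_S in E.
      replace (2 * z)%C with (RtoC (INR (k + 2)) - (1 - 2 * z + (INR k + 1)))%C.
      * rewrite E. replace (INR (k + 2) - 0)%C with (RtoC (INR (k + 2))) by ring.
        rewrite Cmod_R, Rabs_right; [reflexivity|apply Rle_ge, pos_INR].
      * rewrite RtoC_INR_plus, RtoC_INR_2. ring.
Qed.

Lemma filterlim_id_punctured (z : C) : filterlim (fun w : C => w) (locally' z) (locally z).
Proof. intros P HP. unfold filtermap. now apply filter_le_within. Qed.

Lemma lhs_term_continuous n (z : C) : (z + INR n)%C <> 0%C ->
  filterlim (lhs_term n) (locally' z) (locally (lhs_term n z)).
Proof.
  intros Hz. pose proof (filterlim_id_punctured z) as Hid.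
  unfold lhs_term.
  assert (HP : forall m, filterlim (fun w : C => pochhammer (2 * w) m) (locally' z)
                 (locally (pochhammer (2 * z) m))).
  { induction m; simpl; [apply filterlim_const|].
    apply (Clim_mult (locally' z)); [exact IHm|].
    apply (Clim_plus (locally' z)); [|apply filterlim_const].
    apply (Clim_mult (locally' z)); [apply filterlim_const|exact Hid]. }
  apply (Clim_div (locally' z)).
  - apply Cmult_neq_0; apply Cpow_nz; [apply RtoC_fact_neq_0|exact Hz].
  - apply (Clim_mult (locally' z)); apply (Clim_pow (locally' z)); auto.
  - apply (Clim_mult (locally' z)); [apply filterlim_const|].
    apply (Clim_pow (locally' z)), (Clim_plus (locally' z)); [exact Hid|apply filterlim_const].
Qed.

(** The same K works for the whole punctured disc, and l may be any limit of the series, so the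
    bound applies both with l = [rhs w] at generic w and at the exceptional point itself. *)
Lemma Csum_lhs_tail (r eps : R) : 0 <= r < 1 -> 0 < eps ->
  exists K, forall (w l : C), w <> 0%C -> Cmod w <= r ->
    filterlim (Csum (fun n => lhs_term n w)) eventually (locally l) ->
    Cmod (l - Csum (fun n => lhs_term n w) K)%C <= eps.
Proof.
  intros Hr He. set (c := 27 / (1 - r) ^ 3).
  assert (Hc : 0 <= c) by (apply Rdiv_le_0_compat; [lra|apply pow_lt; lra]).
  set (e := fun k => c * lhs_majorant (2 * r) k).
  destruct (Rsum_tail e (c * / (2 - 2 * r))) with (eps := eps) as [K HK]; auto.
  - intros k. apply Rmult_le_pos; auto. apply lhs_majorant_ge_0.
  - intros n. apply Rsum_lhs_majorant_scal; lra.
  - exists K. intros w l Hw Hwr Hl.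
    apply (Clim_le eventually (fun n => Csum (fun n => lhs_term n w) n
                                        - Csum (fun n => lhs_term n w) K)%C).
    + exists K. intros n Hn. left. eapply Rle_lt_trans; [|apply (HK n)].
      apply Csum_tail_le; auto. intros k. apply lhs_term_le; auto. lra.
    + apply (Clim_minus eventually); [exact Hl|apply filterlim_const].
Qed.

Lemma locally'_near (z : C) (d : R) : 0 < d ->
  locally' z (fun w : C => Cmod (w - z)%C < d /\ w <> z).
Proof.
  intros Hd. unfold locally', within.
  pose proof (proj1 (filterlim_Cmod (locally z) (fun y => y) z) (fun P HP => HP) d Hd) as H.
  revert H. apply filter_imp. auto.
Qed.

(** Near z, but off it, [rhs w] is the sum of the series at w, so it is compared with l through the
    K-th partial sums at w and z; the three errors are eps/4 each. *)
Lemma rhs_limit_half (z l : C) : z = (1 / 2)%C \/ z = (- (1 / 2))%C ->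
  filterlim (Csum (fun n => lhs_term n z)) eventually (locally l) ->
  filterlim rhs (locally' z) (locally l).
Proof.
  intros Hz Hl.
  assert (Hhalf : Cmod (1 / 2)%C = 1 / 2).
  { rewrite <- RtoC_div, Cmod_R, Rabs_right by lra. reflexivity. }
  assert (Hone : Cmod (1 / 2 - - (1 / 2))%C = 1).
  { replace (1 / 2 - - (1 / 2))%C with (RtoC 1).
    - apply Cmod_1.
    - field. }
  assert (Hmod : Cmod z = 1 / 2).
  { destruct Hz as [-> | ->]; [|rewrite Cmod_opp]; exact Hhalf. }
  assert (Hz0 : z <> 0%C) by (apply Cmod_gt_0; lra).
  apply filterlim_Cmod; [typeclasses eauto|]. intros eps He.
  destruct (Csum_lhs_tail (3 / 4) (eps / 4)) as [K HK]; [lra|lra|].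
  assert (Hc : filterlim (fun w => Csum (fun n => lhs_term n w) K) (locally' z)
                 (locally (Csum (fun n => lhs_term n z) K))).
  { clear - Hz0 Hmod. induction K; simpl; [apply filterlim_const|].
    apply (Clim_plus (locally' z)); [exact IHK|]. apply lhs_term_continuous.
    destruct K as [|K]; [simpl; now rewrite Cplus_0_r|].
    apply Cmod_gt_0. rewrite Cplus_comm. pose proof (Cmod_INR_plus_ge (S K) z) as H.
    rewrite S_INR in *. pose proof (pos_INR K). lra. }
  pose proof (proj1 (filterlim_Cmod (locally' z) _ _) Hc (eps / 4) ltac:(lra)) as Hc'.
  (* Since |z| = 1/2, this radius gives 1/4 < |w| < 3/4: w is nonzero, within the disc of the
     uniform tail, and away from the other exceptional point, which lies at distance 1. *)
  pose proof (locally'_near z (1 / 4) ltac:(lra)) as Hn.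
  generalize (filter_and _ _ Hc' Hn). apply filter_imp.
  match goal with |- forall x, @?P x => change (forall x : C, P x) end.
  intros w [H1 [H2 H3]].
  pose proof (Cmod_triangle_minus w z) as H4.
  pose proof (Cmod_triangle_minus z w) as H5.
  replace (z - w)%C with (- (w - z))%C in H4 by ring. rewrite Cmod_opp in H4.
  assert (Hw : w <> 0%C) by (apply Cmod_gt_0; lra).
  assert (Hw1 : w <> (1 / 2)%C).
  { intros ->. destruct Hz as [-> | ->]; [auto|]. lra. }
  assert (Hw2 : w <> (- (1 / 2))%C).
  { intros ->. destruct Hz as [-> | ->]; [|auto].
    replace (- (1 / 2) - 1 / 2)%C with (- (1 / 2 - - (1 / 2)))%C in H2 by ring.
    rewrite Cmod_opp in H2. lra. }
  pose proof (HK w (rhs w) Hw ltac:(lra)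
    (lhs_series_cv_generic w ltac:(lra) Hw Hw1 Hw2)) as B1.
  pose proof (HK z l Hz0 ltac:(lra) Hl) as B2.
  replace (rhs w - l)%C with ((rhs w - Csum (fun n => lhs_term n w) K)
     + ((Csum (fun n => lhs_term n w) K - Csum (fun n => lhs_term n z) K)
     + - (l - Csum (fun n => lhs_term n z) K)))%C by ring.
  eapply Rle_lt_trans; [apply Cmod_triangle|].
  eapply Rle_lt_trans; [apply Rplus_le_compat_l, Cmod_triangle|].
  rewrite Cmod_opp. lra.
Qed.

Lemma lhs_series_ex (z : C) : Cmod z < 1 -> z <> 0%C ->
  exists l : C, filterlim (Csum (fun n => lhs_term n z)) eventually (locally l).
Proof.
  intros Hz H0. pose proof (Cmod_ge_0 z).
  apply Csum_abs_cv with (e := fun k => 27 / (1 - Cmod z) ^ 3 * lhs_majorant (2 * Cmod z) k)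
    (B := 27 / (1 - Cmod z) ^ 3 * / (2 - 2 * Cmod z)).
  - intros n. apply lhs_term_le; auto. lra.
  - intros n. apply Rsum_lhs_majorant_scal; [lra|].
    apply Rdiv_le_0_compat; [lra|apply pow_lt; lra].
Qed.

(** At 0 all Gamma values are Gamma(1), which is nonzero, and z^2 removes both polygamma terms; the
    formula can be evaluated as it stands. *)
Lemma rhs_0 : rhs 0 = 1%C.
Proof.
  assert (HG : Gamma 1 <> 0%C) by apply (Gamma_cv 1), one_plus_INR_neq_0.
  unfold rhs. rewrite Cmult_0_r, !Cplus_0_r.
  replace (1 - 0)%C with (RtoC 1) by ring. simpl. field. exact HG.
Qed.

Lemma lhs_term_at_0 n : lhs_term (S n) 0 = 0%C.
Proof. unfold lhs_term, Cdiv. simpl. ring. Qed.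

Theorem corollary2 :
  forall z : C, (Cmod z < 1)%R ->
  exists (t : nat -> C) (s : C),
    (forall n : nat,
       extended_value (lhs_term n) (fun w => n = 0%nat /\ w = 0) z (t n)) /\
    is_series t s /\
    extended_value rhs (fun w => w = 1 / 2 \/ w = - (1 / 2)) z s.
Proof.
  intros z Hz. destruct (Ceq_dec z 0) as [->|H0].
  (* Only the term n = 0 is 0/0 at z = 0; off 0 it is identically 1, hence so is its extension,
     while the other terms vanish through z^3. *)
  - exists (fun n => match n with O => 1%C | S m => 0%C end), 1%C. split; [|split].
    + intros n. split.
      * intros Hn. destruct n; [exfalso; auto|apply lhs_term_at_0].
      * intros [-> _].
        apply filterlim_ext_loc with (f := fun _ : C => RtoC 1); [|apply filterlim_const].
        generalize (locally'_near 0 1 Rlt_0_1). apply filter_imp.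
        intros w [_ Hw]. symmetry. apply lhs_term_0, Hw.
    + apply is_series_Csum. apply filterlim_ext_loc with (f := fun _ : nat => RtoC 1).
      * exists 1%nat. intros n Hn. destruct n as [|n]; [lia|]. clear Hn.
        induction n; [simpl; ring|]. simpl in *. rewrite <- IHn. ring.
      * apply filterlim_const.
    + split; [intros _; apply rhs_0|].
      intros [E|E]; apply RtoC_inj in E; exfalso; lra.
  - destruct (lhs_series_ex z Hz H0) as [s Hs].
    exists (fun n => lhs_term n z), s. split; [|split].
    + intros n. split; [reflexivity|]. intros [_ E]. contradiction.
    + apply is_series_Csum, Hs.
    (* The statement takes 1/2 as an embedded real number, the preceding lemmas as a quotient of
       complex numbers. *)
    + assert (E1 : RtoC (1 / 2) = (1 / 2)%C) by (apply RtoC_div; lra).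
      assert (E2 : RtoC (- (1 / 2)) = (- (1 / 2))%C) by (rewrite RtoC_opp, E1; reflexivity).
      split.
      * rewrite E1, E2. intros Hn. apply (Clim_unique eventually (Csum (fun n => lhs_term n z))); [|exact Hs].
        apply lhs_series_cv_generic; auto.
      * rewrite E1, E2. intros Hh. apply rhs_limit_half; auto.
Qed.
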